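(* Assume the following. (a) $\mathcal{D}$ is a (finite or infinite) discrete subset of $\mathbb{R}$ with no accumulation points. (b) $f(x)\ge0$ is a non-trivial function on $\mathbb{R}$ which is analytic in a neighborhood $\Omega=\{z=x+iy:x\in\mathbb{R},|y|<\delta\}$ of $\mathbb{R}$ for some $\delta>0$, and the discrete Hankel determinant $\mathbf{H}_n(f,\mathcal{D})$ is well defined. (c) $b(z)$ is a non-trivial analytic function in $\Omega$ such that $b(x)\ge0$ for $x\in\mathbb{R}$ and $|z|^k|f(z)b(z)|\to0$ as $|z|\to\infty$ in $\Omega$ for every $k\ge0$. (d) $\gamma(z)$ is an analytic function in $\Omega$ such that $\gamma$ vanishes exactly on $\mathcal{D}$, all its roots are simple, and $\left|z^kf(z)\frac{\gamma'(z)}{\gamma(z)}\right|\to0$ as $z\in\Omega$, $|\mathrm{Re}(z)|\to\infty$, for all $k\ge0$. Let $p_k(x)$ be the orthonormal polynomials with respect to the weight $f(x)b(x)$ on $\mathbb{R}$, let $\kappa_k$ be the leading coefficient of $p_k$, and set $$K_{CD}(z,w)=\frac{\kappa_{n-1}}{\kappa_n}\,\frac{p_n(z)p_{n-1}(w)-p_{n-1}(z)p_n(w)}{z-w}.$$ Then $$\mathbf{H}_n(f,\mathcal{D})=\mathcal{H}_n(fb)\,\det(1+K)_{L^2(C_+\cup C_-,\,dz)},$$ where $K$ is the integral operator with kernel $$K(z,w)=K_{CD}(z,w)\sqrt{f(z)f(w)v(z)v(w)},$$ where $C_\pm=\mathbb{R}\pm i\delta/2$, oriented from left to right, and $$v(z)=\begin{cases}-\dfrac{\gamma'(z)}{2\pi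 i\,\gamma(z)}-\dfrac{b(z)}2,& z\in C_+,\\[2mm] \dfrac{\gamma'(z)}{2\pi i\,\gamma(z)}-\dfrac{b(z)}2,& z\in C_-.\end{cases}$$
   Context: The discrete Hankel determinant is $\mathbf{H}_n(f,\mathcal{D})=\det\Big[\sum_{x\in\mathcal{D}}x^{j+k}f(x)\Big]_{j,k=0}^{n-1}$ and the continuous Hankel determinant is $\mathcal{H}_n(h)=\det\Big[\int_{\mathbb{R}}x^{j+k}h(x)\,dx\Big]_{j,k=0}^{n-1}$. The determinant $\det(1+K)$ is the Fredholm determinant with respect to the complex measure $dz$ on $C_+\cup C_-$. The factor $\sqrt{f(z)f(w)v(z)v(w)}$ is read as $g(z)g(w)$, where $g$ is a fixed choice of square root of $fv$ on $C_+\cup C_-$. *)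

(* Defs.v *)
From HB Require Import structures.
From mathcomp Require Import all_boot all_order all_algebra.
From mathcomp Require Import complex.
From mathcomp Require Import all_classical all_reals all_analysis.
Set Implicit Arguments.
Unset Strict Implicit.
Unset Printing Implicit Defensive.
Import Order.TTheory GRing.Theory Num.Theory.
Import numFieldNormedType.Exports.
Local Open Scope classical_set_scope.
Local Open Scope complex_scope.
Local Open Scope ring_scope.

(* [normc z] is the modulus of [z] as an element of [R]; the generic norm
   [`|z|] of [R[i]] takes its values in [R[i]]. *)
Notation normc := complex.ComplexField.Normc.normc.

(* the metric topology of [R[i]], and [R[i]] as a normed space over itself *)
HB.instance Definition _ (R : realType) := NormedModule.copy R[i] R[i]^o.

Section ComplexAnalysis.
Variable R : realType.
Local Notation C := R[i].
Local Notation mu := (@lebesgue_measure R).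

Definition strip (delta : R) : set C := [set z | `|complex.Im z| < delta].

(* [derivable] over the field [R[i]] is complex differentiability; it is meant for open sets [A]. *)
Definition analytic_on (A : set C) (phi : C -> C) : Prop :=
  forall z, A z -> derivable phi z 1.

(* [phi z --> 0] as [h z --> +oo] with [z] in [A] *)
Definition vanishes_at_infty (A : set C) (h phi : C -> R) : Prop :=
  forall e : R, 0 < e ->
    exists M : R, forall z, A z -> M < h z -> `|phi z| < e.

Definition cintegrable (F : R -> C) : Prop :=
  mu.-integrable setT (EFin \o (fun x => complex.Re (F x))) /\
  mu.-integrable setT (EFin \o (fun x => complex.Im (F x))).

Definition cintegral (F : R -> C) : C :=
  (\int[mu]_x complex.Re (F x))%R +i* (\int[mu]_x complex.Im (F x))%R.

(* The contour [C_+ \cup C_-] with [C_\pm = R \pm i delta / 2]. Both lines are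
   oriented from left to right, so that [dz = dx] on each of them. *)
Definition contour (delta : R) : set C :=
  [set z | complex.Im z = delta / 2 \/ complex.Im z = - (delta / 2)].

Definition contour_integrable (delta : R) (F : C -> C) : Prop :=
  cintegrable (fun x => F (x +i* (delta / 2))) /\
  cintegrable (fun x => F (x -i* (delta / 2))).

Definition contour_integral (delta : R) (F : C -> C) : C :=
  cintegral (fun x => F (x +i* (delta / 2))) +
  cintegral (fun x => F (x -i* (delta / 2))).

(* The k-fold integral over [C_+ \cup C_-] of [F [:: z_1; ...; z_k]] with
   respect to [dz_1 ... dz_k], as an iterated integral. *)
Fixpoint contour_mintegral (delta : R) (k : nat) (F : seq C -> C) : C :=
  if k is k'.+1 then
    contour_integral delta
      (fun z => contour_mintegral delta k' (fun s => F (z :: s)))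
  else F [::].

Fixpoint contour_mintegrable (delta : R) (k : nat) (F : seq C -> C) : Prop :=
  if k is k'.+1 then
    (forall z, contour delta z ->
       contour_mintegrable delta k' (fun s => F (z :: s))) /\
    contour_integrable delta
      (fun z => contour_mintegral delta k' (fun s => F (z :: s)))
  else True.

Definition kernel_det (K : C -> C -> C) (k : nat) (s : seq C) : C :=
  \det (\matrix_(i < k, j < k) K s`_i s`_j).

(* The Fredholm series
   [\sum_k (1/k!) \int ... \int det (K(z_i, z_j))_{i,j} dz_1 ... dz_k]. *)
Definition fredholm_term (delta : R) (K : C -> C -> C) (k : nat) : C :=
  (k`!%:R)^-1 * contour_mintegral delta k (kernel_det K k).

Definition fredholm_well_defined (delta : R) (K : C -> C -> C) : Prop :=
  (forall k, contour_mintegrable delta k (kernel_det K k)) /\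
  cvgn (series (fredholm_term delta K)).

Definition fredholm_det (delta : R) (K : C -> C -> C) : C :=
  limn (series (fredholm_term delta K)).

End ComplexAnalysis.

Section Hankel.
Variable R : realType.
Local Notation C := R[i].
Local Notation mu := (@lebesgue_measure R).

Definition on_real (phi : C -> C) (x : R) : R := complex.Re (phi x%:C).

(* [\sum_(x in D) a x]: the positive part minus the negative part, which is
   the sum of the family when it is absolutely summable. *)
Definition dsum (D : set R) (a : R -> R) : R :=
  fine (esum D (EFin \o a)^\+ - esum D (EFin \o a)^\-)%E.

Definition discrete_hankel_defined (n : nat) (f : R -> R) (D : set R) : Prop :=
  forall j k : 'I_n, summable D (fun x => (x ^+ (j + k) * f x)%:E).

Definition discrete_hankel (n : nat) (f : R -> R) (D : set R) : R :=
  \det (\matrix_(j < n, k < n) dsum D (fun x => x ^+ (j + k) * f x)).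

Definition hankel (n : nat) (h : R -> R) : R :=
  \det (\matrix_(j < n, k < n) (\int[mu]_x (x ^+ (j + k) * h x))%R).

(* No sign is imposed on the leading coefficients: [K_CD] does not depend on
   it. *)
Definition orthonormal_polys (w : R -> R) (p : nat -> {poly R}) : Prop :=
  (forall k, size (p k) = k.+1) /\
  (forall j k,
     mu.-integrable setT (EFin \o (fun x => (p j).[x] * (p k).[x] * w x)) /\
     (\int[mu]_x ((p j).[x] * (p k).[x] * w x))%R = (j == k)%:R).

Definition kappa (p : nat -> {poly R}) (k : nat) : R := lead_coef (p k).

Definition ceval (q : {poly R}) (z : C) : C := (map_poly (real_complex R) q).[z].

(* On the diagonal, where the quotient is 0/0, the kernel is given by its
   limit as [w --> z]. *)
Definition K_CD (p : nat -> {poly R}) (n : nat) (z w : C) : C :=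
  (kappa p n.-1 / kappa p n)%:C *
  (if z == w then
     ceval (deriv (p n)) z * ceval (p n.-1) z - ceval (deriv (p n.-1)) z * ceval (p n) z
   else
     (ceval (p n) z * ceval (p n.-1) w - ceval (p n.-1) z * ceval (p n) w)
       / (z - w)).

Definition logderiv (gamma : C -> C) (z : C) : C := derive1 gamma z / gamma z.

Definition two_pi_i : C := 0 +i* (2 * pi).

(* Only the values on [C_+] (where [Im z = delta / 2 > 0]) and on [C_-] are
   used. *)
Definition vfun (gamma b : C -> C) (z : C) : C :=
  if 0 < complex.Im z then - (logderiv gamma z / two_pi_i) - b z / 2
  else logderiv gamma z / two_pi_i - b z / 2.

Definition vanishes_exactly_on (A : set C) (gamma : C -> C) (D : set R) : Prop :=
  forall z, A z -> (gamma z = 0 <-> exists2 x : R, D x & z = x%:C).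

(* Decay of [z^k f gamma'/gamma] in the strip. The function has a pole at every
   point of [D] at which [f] does not vanish, so for infinite [D] the limit only
   makes sense away from [D]: it is taken outside some family of pairwise
   disjoint open discs centred at the points of [D] and not reaching beyond
   [C_+] and [C_-]. Decay on the whole of the strip
   minus [D] implies this for every such family. *)
Definition discs (D : set R) (r : R -> R) : set C :=
  [set z | exists2 x : R, D x & normc (z - x%:C) < r x].

Definition logderiv_decay (delta : R) (D : set R) (f gamma : C -> C) : Prop :=
  exists r : R -> R,
    [/\ forall x, D x -> 0 < r x <= delta / 2,
        forall x y, D x -> D y -> x != y -> r x + r y <= `|x - y| &
        forall k : nat,
          vanishes_at_infty (strip delta `\` discs D r)
            (fun z => `|complex.Re z|)
            (fun z => normc (z ^+ k * f z * logderiv gamma z))].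

End Hankel.

(* Main.v *)
Require Import Defs.
From HB Require Import structures.
From mathcomp Require Import all_boot all_order all_algebra.
From mathcomp Require Import fingroup perm complex.
From mathcomp Require Import all_classical all_reals all_analysis.
From mathcomp Require Import measurable_realfun.
From mathcomp Require Import ring lra.
Set Implicit Arguments.
Unset Strict Implicit.
Unset Printing Implicit Defensive.
Import Order.TTheory GRing.Theory Num.Theory.
Import numFieldNormedType.Exports.

(* By Christoffel-Darboux, K(z,w) = sum_(l<n) p_l(z) p_l(w) g(z) g(w) has finite
   rank, and g enters the determinants of the Fredholm series only through
   g(z)^2 = f(z) v(z).  Expanding these determinants into sums of products of
   functions of one variable, the series becomes det(1 + M), where M_(l,m) is the
   contour integral of p_l p_m f v.

   Integrating z^k f gamma'/gamma over rectangles exhausting the strip between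
   C_- and C_+ (residues at the points of D), and moving the integrals of z^k f b
   to the real axis, gives
     contour integral of z^k f v = sum_(x in D) x^k f(x) - int_R x^k f b,
   that is V = H_discrete - H_continuous for the Hankel matrices.  If L is the
   coefficient matrix of p_0, ..., p_(n-1), orthonormality reads L H L^T = 1 and
   M = L V L^T, so det(H_discrete) = det(H + V) = det(H) det(1 + M). *)

(** The decay of [z^k f gamma'/gamma] is available only outside discs around the points of [D], and
    neither the radii nor the gaps between the discs are bounded below. Vertical sides at prescribed
    abscissae could therefore cross discs. As the discs are disjoint, an abscissa covered by one of
    them can be moved to an end of its projection; hence the limit lemmas assume of the endpoints
    only [A k <= - k] and [k <= B k]. The horizontal sides are safe because the radii are at most
    [delta / 2]. Residues are computed without Laurent series: a simple zero [p] of [gamma] is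
    divided out, so that [gamma'/gamma] splits into [1/(z - p)] and a logarithmic derivative with
    one zero fewer. This requires the quotient to be analytic at [p], and so rests on Cauchy's
    formula and on differentiation of Cauchy-type integrals. The opposite signs of [gamma'/gamma] in
    [v] turn the two lines, both oriented left to right, into a counterclockwise boundary. The term
    [- b/2] has the same sign on both lines, as each line carries the full real integral of
    [z^k f b]. *)

Local Open Scope ring_scope.

(** * The Fredholm expansion of a finite determinant *)

Section FredholmDeterminant.
Variable F : fieldType.

(** Sylvester's identity: [E] writes one block matrix as a product of triangular blocks in two ways,
    and the determinants leave only the blocks [1 + AB] and [1 + BA]. *)
Lemma det_1D_mulmxC (m n : nat) (A : 'M[F]_(m, n)) (B : 'M[F]_(n, m)) :
  \det (1%:M + A *m B) = \det (1%:M + B *m A).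
Proof.
have E : block_mx 1%:M 0 A 1%:M *m block_mx 1%:M (- B) 0 (1%:M + A *m B) =
         block_mx (1%:M + B *m A) (- B) 0 1%:M *m block_mx 1%:M 0 A 1%:M.
  rewrite !mulmx_block !mul1mx !mulmx1 !mul0mx !mulmx0 !addr0 !add0r mulmxN mulNmx addrK.
  by rewrite addrCA addNr addr0.
have := congr1 determinant E.
by rewrite !det_mulmx !det_lblock !det_ublock !det1 !mul1r !mulr1.
Qed.

Lemma det_mxsub_noninj (n k : nat) (M : 'M[F]_n) (phi : 'I_k -> 'I_n) :
  ~~ injectiveb phi -> \det (mxsub phi phi M) = 0.
Proof.
move=> /injectivePn[i [j ij phiij]].
by apply: (determinant_alternate ij) => l; rewrite !mxE phiij.
Qed.

(** The determinant of this matrix is the principal minor of [M] on [S]. Keeping the size [n] puts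
    the minors of all orders in one type, ready to be summed over [S]. *)
Definition mask_mx (n : nat) (M : 'M[F]_n) (S : {set 'I_n}) : 'M[F]_n :=
  \matrix_(i, j) if i \in S then M i j else (i == j)%:R.

(* If [P] is the 0-1 matrix that selects the rows in the image of [phi], then
   [mxsub phi phi M = 1 + (P (M - 1)) P^T] and [mask_mx M _ = 1 + P^T (P (M - 1))]. *)
Lemma det_mxsub_inj (n k : nat) (M : 'M[F]_n) (phi : 'I_k -> 'I_n) :
  injective phi -> \det (mxsub phi phi M) = \det (mask_mx M [set phi i | i : 'I_k]).
Proof.
move=> phi_inj; pose P : 'M[F]_(k, n) := \matrix_(a, i) (phi a == i)%:R.
have PM (q : nat) (A : 'M[F]_(n, q)) a j : (P *m A) a j = A (phi a) j.
  rewrite mxE (bigD1 (phi a))//= mxE eqxx mul1r big1 ?addr0// => i ia.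
  by rewrite mxE eq_sym (negPf ia) mul0r.
have MP (q : nat) (A : 'M[F]_(q, n)) i a : (A *m P^T) i a = A i (phi a).
  rewrite mxE (bigD1 (phi a))//= !mxE eqxx mulr1 big1 ?addr0// => j ja.
  by rewrite !mxE eq_sym (negPf ja) mulr0.
have -> : mxsub phi phi M = 1%:M + (P *m (M - 1%:M)) *m P^T.
  apply/matrixP => a c; rewrite [RHS]mxE MP PM !mxE (inj_eq phi_inj) /=.
  by rewrite addrC subrK.
rewrite -det_1D_mulmxC; congr (\det _); apply/matrixP => i j.
rewrite [LHS]mxE [1%:M i j]mxE [(_ *m _) i j]mxE [RHS]mxE; case: ifPn => [/imsetP[a _ ->]|iS].
  rewrite (bigD1 a)//= PM !mxE eqxx mul1r big1 ?addr0 => [|c ca].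
    by rewrite addrC subrK.
  by rewrite !mxE (inj_eq phi_inj) (negPf ca) mul0r.
rewrite big1 ?addr0// => a _; rewrite !mxE; case: eqP => [E|_]; last by rewrite mul0r.
by case/negP: iS; apply/imsetP; exists a.
Qed.

(** Expansion in principal minors: in the Leibniz formula each row chooses between its entry of [M]
    and its entry of [1], and [S] records the rows that choose [M]. *)
Lemma det_1D_mask (n : nat) (M : 'M[F]_n) :
  \det (1%:M + M) = \sum_(S : {set 'I_n}) \det (mask_mx M S).
Proof.
rewrite /determinant exchange_big /=; apply: eq_bigr => s _.
rewrite -mulr_sumr; congr (_ * _).
under eq_bigr => i _ do rewrite mxE addrC [1%:M _ _]mxE.
pose G (i : 'I_n) (c : bool) := if c then M i (s i) else (i == s i)%:R.
rewrite (eq_bigr (fun i => \sum_(c : bool) G i c)); last by move=> i _; rewrite big_bool.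
(* The product of two-term sums becomes a sum over boolean functions, which are then read as
   indicators of sets [S]. *)
rewrite bigA_distr_bigA /=.
rewrite (reindex (fun S : {set 'I_n} => [ffun i => i \in S])) /=; last first.
  exists (fun e : {ffun 'I_n -> bool} => [set i | e i]) => [S _|e _].
    by apply/setP => i; rewrite !inE ffunE.
  by apply/ffunP => i; rewrite ffunE inE.
by apply: eq_bigr => S _; apply: eq_bigr => i _; rewrite ffunE /G mxE.
Qed.

(** This count is what the factor [1/k!] of the Fredholm series compensates: a principal minor of
    order [k] arises once from each enumeration of its index set. *)
Lemma card_inj_onto (n k : nat) (S : {set 'I_n}) :
  #|[set phi : {ffun 'I_k -> 'I_n} | injectiveb phi & [set phi i | i : 'I_k] == S]| =
  if #|S| == k then k`! else 0%N.
Proof.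
case: eqP => [Sk|Sk]; last first.
  apply: eq_card0 => phi; rewrite !inE; apply/negP => /andP[/injectiveP inj /eqP E].
  by apply: Sk; rewrite -E card_imset// card_ord.
have -> : k`! = (#|S| ^_ #|'I_k|)%N by rewrite Sk card_ord ffactnn.
rewrite -card_inj_ffuns_on.
apply: eq_card => phi; rewrite !inE andbC; case: injectiveP => [inj|_]; last by rewrite !andbF.
rewrite !andbT; apply/eqP/ffun_onP => [<- i|H]; first by apply/imsetP; exists i.
apply/eqP; rewrite eqEcard card_imset// card_ord Sk leqnn andbT.
by apply/fintype.subsetP => _ /imsetP[i _ ->].
Qed.

(** Only injective [phi] contribute, and their minors depend on [phi] through its image alone, so
    the sum is organized by images. *)
Lemma sum_det_mxsub (n k : nat) (M : 'M[F]_n) :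
  \sum_(phi : {ffun 'I_k -> 'I_n}) \det (mxsub phi phi M) =
  (\sum_(S : {set 'I_n} | #|S| == k) \det (mask_mx M S)) *+ k`!.
Proof.
rewrite (bigID (fun phi : {ffun 'I_k -> 'I_n} => injectiveb phi)) /= [X in _ + X]big1 ?addr0; last first.
  by move=> phi; exact: det_mxsub_noninj.
rewrite (partition_big (fun phi : {ffun 'I_k -> 'I_n} => [set phi i | i : 'I_k]) predT)//=.
rewrite -sumrMnl [RHS]big_mkcond /=; apply: eq_bigr => S _.
rewrite (eq_bigr (fun=> \det (mask_mx M S))); last first.
  by move=> phi /andP[/injectiveP inj /eqP <-]; exact: det_mxsub_inj.
rewrite sumr_const; have := card_inj_onto k S; rewrite cardsE => ->.
by case: ifP => // _; rewrite mulr0n.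
Qed.

Lemma sum_det_mxsub0 (n k : nat) (M : 'M[F]_n) : (n < k)%N ->
  \sum_(phi : {ffun 'I_k -> 'I_n}) \det (mxsub phi phi M) = 0.
Proof.
move=> nk; rewrite sum_det_mxsub big1 ?mul0rn// => S /eqP Sk.
by have := max_card (mem S); rewrite Sk card_ord leqNgt nk.
Qed.

(** The Fredholm expansion in finite dimension: the principal minors of [det_1D_mask] grouped by
    their order [k]. *)
Lemma det_1D_fredholm (n : nat) (M : 'M[F]_n) : (forall k, k`!%:R != 0 :> F) ->
  \det (1%:M + M) = \sum_(0 <= k < n.+1)
    (k`!%:R)^-1 * \sum_(phi : {ffun 'I_k -> 'I_n}) \det (mxsub phi phi M).
Proof.
move=> fact0; rewrite det_1D_mask big_mkord.
(* The cardinality of [S] is at most [n], so [inord] does not alter it. *)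
rewrite (partition_big (fun S : {set 'I_n} => inord #|S| : 'I_n.+1) predT)//=.
apply: eq_bigr => k _; rewrite sum_det_mxsub -[X in _ * X]mulr_natl mulKf//.
apply: eq_bigl => S; rewrite -val_eqE /= inordK// ltnS.
by have := max_card (mem S); rewrite card_ord.
Qed.

End FredholmDeterminant.

Local Open Scope classical_set_scope.
Local Open Scope complex_scope.
Local Open Scope ring_scope.

(** * Moduli and complex derivatives *)

Section ComplexBasics.
Variable R : realType.
Local Notation C := R[i].
Implicit Types (z w : C) (F : C -> C).

Lemma normc_ge0 z : 0 <= normc z.
Proof. by case: z => a b; rewrite sqrtr_ge0. Qed.

Lemma normc_eq0 z : (normc z == 0) = (z == 0).
Proof.
apply/eqP/eqP => [|->]; first exact: complex.ComplexField.Normc.eq0_normc.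
exact: complex.ComplexField.Normc.normc0.
Qed.

Lemma normc_gt0 z : (0 < normc z) = (z != 0).
Proof. by rewrite lt_def normc_ge0 andbT normc_eq0. Qed.

Lemma normc_real (x : R) : normc x%:C = `|x|.
Proof. by rewrite /= expr0n /= addr0 sqrtr_sqr. Qed.

Lemma normc_i : normc ('i : C) = 1.
Proof. by rewrite /= expr0n /= expr1n add0r sqrtr1. Qed.

Lemma le_normcD z w : normc (z + w) <= normc z + normc w.
Proof. by have := ler_normD z w; rewrite -lecR rmorphD. Qed.

Lemma normcN z : normc (- z) = normc z.
Proof. by case: z => a b /=; rewrite !sqrrN. Qed.

Lemma normcBC z w : normc (z - w) = normc (w - z).
Proof. by rewrite -normcN opprB. Qed.

Lemma le_normcB z w : normc (z - w) <= normc z + normc w.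
Proof. by rewrite -(normcN w) le_normcD. Qed.

Lemma le_normc_sub z w : normc z - normc w <= normc (z - w).
Proof. by rewrite lerBlDr -{1}(subrK w z) le_normcD. Qed.

Lemma normcM z w : normc (z * w) = normc z * normc w.
Proof. exact: complex.ComplexField.Normc.normcM. Qed.

Lemma normcV z : normc z^-1 = (normc z)^-1.
Proof. exact: complex.ComplexField.Normc.normcV. Qed.

Lemma normcX z k : normc (z ^+ k) = normc z ^+ k.
Proof.
elim: k => [|k IH]; first by rewrite !expr0 complex.ComplexField.Normc.normc1.
by rewrite !exprS normcM IH.
Qed.

Lemma normc_Re z : `|complex.Re z| <= normc z.
Proof. case: z => a b /=; rewrite -sqrtr_sqr ler_wsqrtr// lerDl sqr_ge0 //. Qed.

Lemma normc_Im z : `|complex.Im z| <= normc z.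
Proof. case: z => a b /=; rewrite -sqrtr_sqr ler_wsqrtr// lerDr sqr_ge0 //. Qed.

Lemma normc_le_ReIm z : normc z <= `|complex.Re z| + `|complex.Im z|.
Proof.
case: z => a b; have -> : a +i* b = a%:C + 'i * b%:C by simpc.
rewrite (le_trans (le_normcD _ _))// normcM normc_i !normc_real mul1r /=.
by simpc; rewrite lexx.
Qed.

Lemma normc_small0 z : (forall e, 0 < e -> normc z <= e) -> z = 0.
Proof.
move=> H; apply/eqP; rewrite -normc_eq0 eq_le normc_ge0 andbT.
by apply/ler_addgt0Pr => e e0; rewrite add0r H.
Qed.

(** The norm of [R[i]] takes values in [R[i]]; this form uses the real modulus, so that all
    estimates take place in [R]. Being free of division, it also covers [w = z]. *)
Definition has_cderiv F z (d : C) := forall e : R, 0 < e ->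
  exists2 r : R, 0 < r & forall w, normc (w - z) < r ->
    normc (F w - F z - d * (w - z)) <= e * normc (w - z).

Lemma has_cderivP F z d : has_cderiv F z d <->
  (h^-1 *: (F (h *: 1 + z) - F z)) @[h --> 0^'] --> d.
Proof.
split=> [H|/cvgrPdist_le H].
(* A positive element of [R[i]] is real, so the imaginary part [e'] of the tolerance is 0. *)
- apply/cvgrPdist_le => -[e e'] /=; rewrite ltcE /= => /andP[/eqP -> e0].
  have [r r0 Hr] := H e e0.
  apply/nbhs_ballP; exists r%:C => /=; first by rewrite ltcR.
  move=> h; rewrite /ball/= sub0r normrN => hr h0.
  rewrite -[_ <= _]/(_ <= e%:C) lecR.
  have := Hr (h + z); rewrite addrK.
  move=> /(_ _) Hh; rewrite -(@ler_pM2r _ (normc h)) ?normc_gt0//.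
  rewrite -normcM [_ *: 1]mulr1 mulrBl -[_ *: _]/(_ * _) mulrAC mulVf// mul1r normcBC.
  by apply: Hh; rewrite -ltcR.
- move=> e e0.
  have /nbhs_ballP[[r r'] /=] : \forall h \near 0^', `|d - h^-1 *: (F (h *: 1 + z) - F z)| <= e%:C.
    by apply: H; rewrite ltcR.
  rewrite ltcE /= => /andP[/eqP -> r0] Hr; exists r => // w wr.
  have [->|wz] := eqVneq w z; first by rewrite !subrr mulr0 subrr normc_real normr0 mulr0.
  have := Hr (w - z); rewrite /ball/= sub0r normrN subr_eq0 => /(_ _ wz).
  rewrite -[_ < _]/(_ < r%:C) ltcR => /(_ wr).
  rewrite -[_ <= _]/(_ <= e%:C) lecR -(@ler_pM2r _ (normc (w - z))) ?normc_gt0 ?subr_eq0//.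
  by rewrite -normcM [_ *: 1]mulr1 subrK mulrBl -[_ *: _]/(_ * _) mulrAC mulVf ?subr_eq0// mul1r [normc (d * _ - _)]normcBC.
Qed.

Lemma derivableP_cderiv F z : derivable F z 1 <-> exists d, has_cderiv F z d.
Proof.
split=> [H|[d /has_cderivP H]]; last by apply/cvg_ex; exists d.
by have /cvg_ex[d /has_cderivP Hd] := H; exists d.
Qed.

Lemma derive1_cderiv F z d : has_cderiv F z d -> derive1 F z = d.
Proof. by move=> /has_cderivP H; rewrite derive1E; apply: cvg_lim. Qed.

Lemma has_cderiv_derive1 F z : derivable F z 1 -> has_cderiv F z (derive1 F z).
Proof. by move=> /derivableP_cderiv[d H]; rewrite (derive1_cderiv H). Qed.

Definition ccont F z := forall e : R, 0 < e ->
  exists2 r : R, 0 < r & forall w, normc (w - z) < r -> normc (F w - F z) <= e.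

Lemma ccont_derivable F z : derivable F z 1 -> ccont F z.
Proof.
move=> /has_cderiv_derive1; set d := derive1 F z => H e e0.
have [r r0 Hr] := H 1 ltr01.
have d1 : 0 < normc d + 1 by rewrite ltr_wpDl// normc_ge0.
exists (Num.min r (e / (normc d + 1))); first by rewrite lt_min r0 divr_gt0.
move=> w; rewrite lt_min => /andP[/Hr wr /ltW we].
rewrite -(subrK (d * (w - z)) (F w - F z)) (le_trans (le_normcD _ _))//.
rewrite (le_trans (lerD wr (lexx _)))// normcM mul1r -{1}(mul1r (normc _)) -mulrDl addrC.
by rewrite mulrC -ler_pdivlMr.
Qed.

Lemma continuous_path F (u : R -> C) (t : R) :
  {for t, continuous (fun x => complex.Re (u x))} ->
  {for t, continuous (fun x => complex.Im (u x))} -> ccont F (u t) ->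
  {for t, continuous (fun x => complex.Re (F (u x)))} /\
  {for t, continuous (fun x => complex.Im (F (u x)))}.
Proof.
move=> c1 c2 cF.
have H (e : R) : 0 < e -> \forall x \near t, normc (F (u x) - F (u t)) <= e.
  move=> e0; have [r r0 Hr] := cF _ e0.
  have r20 : 0 < r / 3 by rewrite divr_gt0.
  have /cvgrPdist_lt/(_ _ r20) n1 := c1.
  have /cvgrPdist_lt/(_ _ r20) n2 := c2.
  near=> x; apply: Hr.
  rewrite (le_lt_trans (normc_le_ReIm _))//.
  have h1 : `|complex.Re (u t) - complex.Re (u x)| < r / 3 by near: x.
  have h2 : `|complex.Im (u t) - complex.Im (u x)| < r / 3 by near: x.
  rewrite !raddfB /= (distrC (complex.Re _)) (distrC (complex.Im _)).
  rewrite (lt_trans (ltrD h1 h2))//; lra.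
split; apply/cvgrPdist_le => e e0.
- near=> x; rewrite -raddfB /= (le_trans (normc_Re _))// normcBC.
  near: x; exact: H.
- near=> x; rewrite -raddfB /= (le_trans (normc_Im _))// normcBC.
  near: x; exact: H.
Unshelve. all: by end_near.
Qed.

End ComplexBasics.
#[local] Arguments complex.ComplexField.Normc.normc : simpl never.

(** * Integrals over intervals and rectangles *)

Section ComplexIntegral.
Variable R : realType.
Local Notation C := R[i].
Local Notation mu := (@lebesgue_measure R).
Implicit Types (A : set R) (F G : R -> C) (a b c : R) (k z : C).

Definition cintable A F :=
  mu.-integrable A (EFin \o (fun x => complex.Re (F x))) /\
  mu.-integrable A (EFin \o (fun x => complex.Im (F x))).

Definition cint A F : C :=
  (\int[mu]_(x in A) complex.Re (F x))%R +i* (\int[mu]_(x in A) complex.Im (F x))%R.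

Lemma ReM (z w : C) : complex.Re (z * w) =
  complex.Re z * complex.Re w - complex.Im z * complex.Im w.
Proof. by case: z; case: w. Qed.

Lemma ImM (z w : C) : complex.Im (z * w) =
  complex.Re z * complex.Im w + complex.Im z * complex.Re w.
Proof. by case: z; case: w. Qed.

Lemma ReD (z w : C) : complex.Re (z + w) = complex.Re z + complex.Re w.
Proof. by case: z; case: w. Qed.

Lemma ImD (z w : C) : complex.Im (z + w) = complex.Im z + complex.Im w.
Proof. by case: z; case: w. Qed.

Section fixed_set.
Variable A : set R.
(* without the cast, [measurable] refers to another measurable structure on [R] *)
Hypothesis mA : measurable (A : set (measurableTypeR R)).

Lemma eq_cint F G : (forall x, A x -> F x = G x) -> cint A F = cint A G.
Proof.
by move=> FG; rewrite /cint; congr (_ +i* _); apply: eq_Rintegral => x /set_mem/FG ->.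
Qed.

Lemma eq_integrable_on (f g : R -> \bar R) : (forall x, A x -> f x = g x) ->
  mu.-integrable A f -> mu.-integrable A g.
Proof. by move=> fg; apply: eq_integrable => // x /set_mem/fg. Qed.

Lemma eq_cintable F G : (forall x, A x -> F x = G x) -> cintable A F -> cintable A G.
Proof.
move=> FG [i1 i2]; by split; [move: i1|move: i2]; apply: eq_integrable_on => x /FG /= ->.
Qed.

Lemma cintableD F G : cintable A F -> cintable A G -> cintable A (fun x => F x + G x).
Proof.
move=> [F1 F2] [G1 G2]; split.
- by apply: (eq_integrable_on _ (integrableD mA F1 G1)) => x _ /=; rewrite ReD.
- by apply: (eq_integrable_on _ (integrableD mA F2 G2)) => x _ /=; rewrite ImD.
Qed.

Lemma cintD F G : cintable A F -> cintable A G ->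
  cint A (fun x => F x + G x) = cint A F + cint A G.
Proof.
move=> [F1 F2] [G1 G2]; rewrite /cint; simpc; congr (_ +i* _).
- by rewrite -RintegralD//; apply: eq_Rintegral => x _; rewrite ReD.
- by rewrite -RintegralD//; apply: eq_Rintegral => x _; rewrite ImD.
Qed.

Lemma cintableZ k F : cintable A F -> cintable A (fun x => k * F x).
Proof.
move=> [F1 F2]; split.
- apply: (eq_integrable_on _ (integrableB mA (integrableZl mA (complex.Re k) F1) (integrableZl mA (complex.Im k) F2))) => x _ /=.
  by rewrite ReM.
- apply: (eq_integrable_on _ (integrableD mA (integrableZl mA (complex.Re k) F2) (integrableZl mA (complex.Im k) F1))) => x _ /=.
  by rewrite ImM.
Qed.

Lemma cintZ k F : cintable A F -> cint A (fun x => k * F x) = k * cint A F.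
Proof.
move=> [F1 F2]; rewrite /cint; case: k => k l; simpc; congr (_ +i* _).
- rewrite -!RintegralZl// -RintegralB//; first by apply: eq_Rintegral => x _; rewrite ReM.
    exact: (integrableZl mA _ F1).
  exact: (integrableZl mA _ F2).
- rewrite -!RintegralZl// -RintegralD//; first by apply: eq_Rintegral => x _; rewrite ImM.
    exact: (integrableZl mA _ F2).
  exact: (integrableZl mA _ F1).
Qed.

Lemma cintableN F : cintable A F -> cintable A (fun x => - F x).
Proof.
by move=> /(cintableZ (-1)); apply: eq_cintable => x _; rewrite mulN1r.
Qed.

Lemma cintN F : cintable A F -> cint A (fun x => - F x) = - cint A F.
Proof.
by move=> /(cintZ (-1)); rewrite mulN1r => <-; apply: eq_cint => x _; rewrite mulN1r.
Qed.

Lemma cintableB F G : cintable A F -> cintable A G -> cintable A (fun x => F x - G x).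
Proof. by move=> iF /cintableN; exact: cintableD. Qed.

Lemma cintB F G : cintable A F -> cintable A G ->
  cint A (fun x => F x - G x) = cint A F - cint A G.
Proof. by move=> iF iG; rewrite cintD ?cintN//; exact: cintableN. Qed.

Lemma cintable0 : cintable A (fun=> 0).
Proof. by split; exact: integrable0. Qed.

Lemma cint0 : cint A (fun=> 0) = 0.
Proof.
rewrite -[RHS](mul0r (cint A (fun=> 0))) -cintZ; last exact: cintable0.
by apply: eq_cint => x _; rewrite mul0r.
Qed.

Lemma cint_sum (I : Type) (s : seq I) (P : pred I) (f : I -> R -> C) :
  (forall i, P i -> cintable A (f i)) ->
  cintable A (fun x => \sum_(i <- s | P i) f i x) /\
  cint A (fun x => \sum_(i <- s | P i) f i x) = \sum_(i <- s | P i) cint A (f i).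
Proof.
move=> H; elim: s => [|i s [IH1 IH2]].
  rewrite big_nil; split; last first.
    by rewrite -[RHS]cint0; apply: eq_cint => x _; rewrite big_nil.
  by apply: (eq_cintable _ cintable0) => x _; rewrite big_nil.
rewrite big_cons; case: ifPn => [Pi|Pi].
  split.
    by apply: (eq_cintable _ (cintableD (H _ Pi) IH1)) => x _; rewrite big_cons Pi.
  rewrite -IH2 -cintD//; last exact: H.
  by apply: eq_cint => x _; rewrite big_cons Pi.
split.
  by apply: (eq_cintable _ IH1) => x _; rewrite big_cons (negPf Pi).
by rewrite -IH2; apply: eq_cint => x _; rewrite big_cons (negPf Pi).
Qed.

End fixed_set.

Definition pcont F t :=
  {for t, continuous (fun x => complex.Re (F x))} /\
  {for t, continuous (fun x => complex.Im (F x))}.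

Lemma itv_integrable a b (f : R -> R) :
  (forall t, a <= t <= b -> {for t, continuous f}) ->
  mu.-integrable `[a, b] (EFin \o f).
Proof.
move=> cf; apply: continuous_compact_integrable; first exact: segment_compact.
by apply: continuous_in_subspaceT => x /set_mem; rewrite /= in_itv => /cf.
Qed.

Lemma itv_cintable a b F :
  (forall t, a <= t <= b -> pcont F t) -> cintable `[a, b] F.
Proof. by move=> H; split; apply: itv_integrable => t /H[]. Qed.

Lemma itv_fin_measure a b (x : R) : a <= b ->
  (\int[mu]_(t in `[a, b]) x)%R = x * (b - a).
Proof.
move=> ab; rewrite Rintegral_cst//=.
rewrite lebesgue_measure_itv /= lte_fin.
case: ifPn => //; rewrite -leNgt => ba.
by have /eqP -> : a == b by [rewrite eq_le ab ba]; rewrite subrr.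
Qed.

Lemma itv_cint_cst a b k : a <= b -> cint `[a, b] (fun=> k) = k * (b - a)%:C.
Proof.
move=> ab; rewrite /cint !itv_fin_measure//; case: k => k l /=; simpc.
by [].
Qed.

Lemma itv_Rint_bound a b (f : R -> R) M : a <= b ->
  mu.-integrable `[a, b] (EFin \o f) ->
  (forall t, a <= t <= b -> `|f t| <= M) ->
  `|(\int[mu]_(t in `[a, b]) f t)%R| <= M * (b - a).
Proof.
move=> ab fi fM; rewrite (le_trans (le_normr_Rintegral _ fi))//.
rewrite -itv_fin_measure//; apply: le_Rintegral => //.
- exact: (integrable_norm fi).
- by apply: itv_integrable => t _; exact: cvg_cst.
Qed.

(** The factor 2 comes from bounding the real and imaginary parts separately; only the order of
    magnitude matters below. *)
Lemma itv_cint_bound a b F M : a <= b -> cintable `[a, b] F ->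
  (forall t, a <= t <= b -> normc (F t) <= M) ->
  normc (cint `[a, b] F) <= 2 * M * (b - a).
Proof.
move=> ab [F1 F2] FM; rewrite (le_trans (normc_le_ReIm _))// -mulrA mulr_natl mulr2n.
rewrite lerD// ?itv_Rint_bound// => t /FM; apply: le_trans.
  exact: normc_Re.
exact: normc_Im.
Qed.

Lemma itv_cint_split a b c F : a <= c <= b -> cintable `[a, b] F ->
  cint `[a, b] F = cint `[a, c] F + cint `[c, b] F.
Proof.
move=> /andP[ac cb] iF.
have H (f : R -> R) : mu.-integrable `[a, b] (EFin \o f) ->
    (\int[mu]_(t in `[a, b]) f t = \int[mu]_(t in `[a, c]) f t + \int[mu]_(t in `[c, b]) f t)%R.
  move=> fi; rewrite -(@Rintegral_itv_obnd_cbnd _ c).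
    by rewrite -(Rintegral_itvB fi) ?bnd_simp// addrC subrK.
  apply: integrableS fi => //; apply: subset_itv; rewrite ?bnd_simp//.
by case: iF => F1 F2; rewrite /cint !H//; simpc.
Qed.

End ComplexIntegral.
#[local] Arguments cint : simpl never.

Section Rectangles.
Variable R : realType.
Local Notation C := R[i].
Implicit Types (h g : C -> C) (a b c d x y e M : R) (k z w : C).

Lemma ccontD h g z : ccont h z -> ccont g z -> ccont (fun w => h w + g w) z.
Proof.
move=> H G e e0; have e20 : 0 < e / 2 by rewrite divr_gt0.
have [r r0 Hr] := H _ e20; have [s s0 Gs] := G _ e20.
exists (Num.min r s); first by rewrite lt_min r0.
move=> w; rewrite lt_min => /andP[/Hr wr /Gs ws].
have -> : h w + g w - (h z + g z) = (h w - h z) + (g w - g z) by ring.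
by rewrite (le_trans (le_normcD _ _))// [e]splitr lerD.
Qed.

Lemma ccontM h g z : ccont h z -> ccont g z -> ccont (fun w => h w * g w) z.
Proof.
move=> H G e e0.
pose m := Num.min 1 (e / (2 * (normc (g z) + normc (h z) + 1))).
have n0 : 0 < normc (g z) + normc (h z) + 1 by rewrite ltr_wpDl// addr_ge0// normc_ge0.
have m0 : 0 < m by rewrite lt_min ltr01 divr_gt0// mulr_gt0.
have [r r0 Hr] := H _ m0; have [s s0 Gs] := G _ m0.
exists (Num.min r s); first by rewrite lt_min r0.
move=> w; rewrite lt_min => /andP[/Hr wr /Gs ws].
have -> : h w * g w - h z * g z =
  (h w - h z) * (g w - g z) + ((h w - h z) * g z + h z * (g w - g z)) by ring.
have m1 : m <= 1 by rewrite ge_min lexx.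
have me : m * (2 * (normc (g z) + normc (h z) + 1)) <= e.
  by rewrite -ler_pdivlMr ?mulr_gt0// ge_min lexx orbT.
rewrite (le_trans (le_normcD _ _))//.
have := le_normcD ((h w - h z) * g z) (h z * (g w - g z)).
rewrite !normcM => le1.
have := normc_ge0 (h w - h z); have := normc_ge0 (g w - g z).
have := normc_ge0 (h z); have := normc_ge0 (g z).
nra.
Qed.

Lemma ccont_cst k z : ccont (fun=> k) z.
Proof.
move=> e e0; exists 1 => // w _.
by rewrite subrr complex.ComplexField.Normc.normc0 ltW.
Qed.

Lemma ccont_id z : ccont id z.
Proof. by move=> e e0; exists e => // w /ltW. Qed.

Lemma ccontN h z : ccont h z -> ccont (fun w => - h w) z.
Proof.
move=> H; have := ccontM (@ccont_cst (-1) z) H.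
by under eq_fun do rewrite mulN1r.
Qed.

Lemma ccontB h g z : ccont h z -> ccont g z -> ccont (fun w => h w - g w) z.
Proof. by move=> H /ccontN; exact: ccontD. Qed.

Definition rect a b c d : set C :=
  [set z | (a <= complex.Re z <= b) && (c <= complex.Im z <= d)].

Definition bdrect a b c d : set C := [set z | rect a b c d z /\
  [|| complex.Re z == a, complex.Re z == b, complex.Im z == c | complex.Im z == d]].

(* counterclockwise *)
Definition rint h a b c d : C :=
  cint `[a, b] (fun t => h (t +i* c)) + 'i * cint `[c, d] (fun s => h (b +i* s))
  - cint `[a, b] (fun t => h (t +i* d)) - 'i * cint `[c, d] (fun s => h (a +i* s)).

Definition rintable h a b c d :=
  [/\ cintable `[a, b] (fun t => h (t +i* c)), cintable `[c, d] (fun s => h (b +i* s)),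
      cintable `[a, b] (fun t => h (t +i* d)) & cintable `[c, d] (fun s => h (a +i* s))].

Lemma ccont_horizontal h y t : ccont h (t +i* y) -> pcont (fun x => h (x +i* y)) t.
Proof.
move=> H; apply: (@continuous_path R h (fun x => x +i* y) t) => //=.
exact: cvg_cst.
Qed.

Lemma ccont_vertical h x t : ccont h (x +i* t) -> pcont (fun y => h (x +i* y)) t.
Proof.
move=> H; apply: (@continuous_path R h (fun y => x +i* y) t) => //=.
exact: cvg_cst.
Qed.

Lemma ccont_rintable h a b c d : a <= b -> c <= d ->
  (forall z, bdrect a b c d z -> ccont h z) -> rintable h a b c d.
Proof.
move=> ab cd H; split; apply: itv_cintable => t /andP[t1 t2].
- by apply: ccont_horizontal; apply: H; rewrite /bdrect /rect /= t1 t2 cd eqxx !lexx ?orbT.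
- by apply: ccont_vertical; apply: H; rewrite /bdrect /rect /= t1 t2 ab eqxx !lexx ?orbT.
- by apply: ccont_horizontal; apply: H; rewrite /bdrect /rect /= t1 t2 cd eqxx !lexx ?orbT.
- by apply: ccont_vertical; apply: H; rewrite /bdrect /rect /= t1 t2 ab eqxx !lexx ?orbT.
Qed.

Lemma bdrect_rect a b c d z : bdrect a b c d z -> rect a b c d z.
Proof. by case. Qed.

Lemma eq_rint h g a b c d : a <= b -> c <= d ->
  (forall z, bdrect a b c d z -> h z = g z) -> rint h a b c d = rint g a b c d.
Proof.
move=> ab cd H; rewrite /rint; congr (_ + 'i * _ - _ - 'i * _); apply: eq_cint => t /=;
  rewrite in_itv /= => /andP[t1 t2]; apply: H;
  by rewrite /bdrect /rect /= t1 t2 ?ab ?cd eqxx !lexx ?orbT.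
Qed.

Lemma rintD h g a b c d : rintable h a b c d -> rintable g a b c d ->
  rint (fun z => h z + g z) a b c d = rint h a b c d + rint g a b c d.
Proof. move=> [h1 h2 h3 h4] [g1 g2 g3 g4]; rewrite /rint !cintD//; ring. Qed.

Lemma rintB h g a b c d : rintable h a b c d -> rintable g a b c d ->
  rint (fun z => h z - g z) a b c d = rint h a b c d - rint g a b c d.
Proof. move=> [h1 h2 h3 h4] [g1 g2 g3 g4]; rewrite /rint !cintB//; ring. Qed.

Lemma rintZ k h a b c d : rintable h a b c d ->
  rint (fun z => k * h z) a b c d = k * rint h a b c d.
Proof. move=> [h1 h2 h3 h4]; rewrite /rint !cintZ//; ring. Qed.

(** There are two sides of each direction, and each brings the factor 2 of [itv_cint_bound]; hence
    the 4. *)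
Lemma rint_bound h a b c d M : a <= b -> c <= d -> rintable h a b c d ->
  (forall z, bdrect a b c d z -> normc (h z) <= M) ->
  normc (rint h a b c d) <= 4 * M * ((b - a) + (d - c)).
Proof.
move=> ab cd [h1 h2 h3 h4] H.
have H1 : normc (cint `[a, b] (fun t => h (t +i* c))) <= 2 * M * (b - a).
  apply: itv_cint_bound => // t /andP[t1 t2]; apply: H.
  by rewrite /bdrect /rect /= t1 t2 cd eqxx !lexx ?orbT.
have H2 : normc (cint `[c, d] (fun t => h (b +i* t))) <= 2 * M * (d - c).
  apply: itv_cint_bound => // t /andP[t1 t2]; apply: H.
  by rewrite /bdrect /rect /= t1 t2 ab eqxx !lexx ?orbT.
have H3 : normc (cint `[a, b] (fun t => h (t +i* d))) <= 2 * M * (b - a).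
  apply: itv_cint_bound => // t /andP[t1 t2]; apply: H.
  by rewrite /bdrect /rect /= t1 t2 cd eqxx !lexx ?orbT.
have H4 : normc (cint `[c, d] (fun t => h (a +i* t))) <= 2 * M * (d - c).
  apply: itv_cint_bound => // t /andP[t1 t2]; apply: H.
  by rewrite /bdrect /rect /= t1 t2 ab eqxx !lexx ?orbT.
rewrite /rint.
rewrite (le_trans (le_normcB _ _))// normcM normc_i mul1r.
have := le_normcB (cint `[a, b] (fun t => h (t +i* c)) + 'i * cint `[c, d] (fun s => h (b +i* s))) (cint `[a, b] (fun t => h (t +i* d))).
have := le_normcD (cint `[a, b] (fun t => h (t +i* c))) ('i * cint `[c, d] (fun s => h (b +i* s))).
rewrite normcM normc_i mul1r; lra.
Qed.

Lemma rint_splitv h a b c d x : a <= x <= b -> rintable h a b c d ->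
  rint h a b c d = rint h a x c d + rint h x b c d.
Proof.
by move=> axb [h1 h2 h3 h4]; rewrite /rint (itv_cint_split axb h1) (itv_cint_split axb h3); ring.
Qed.

Lemma rint_splith h a b c d y : c <= y <= d -> rintable h a b c d ->
  rint h a b c d = rint h a b c y + rint h a b y d.
Proof.
by move=> cyd [h1 h2 h3 h4]; rewrite /rint (itv_cint_split cyd h2) (itv_cint_split cyd h4); ring.
Qed.

(** On opposite sides the integrand differs by a constant, so the two pairs of sides can be
    integrated explicitly, and they cancel. This removes the first-order part of a function in
    Goursat's argument. *)
Lemma rint_affine k w z a b c d : a <= b -> c <= d ->
  rint (fun u => k + w * (u - z)) a b c d = 0.
Proof.
move=> ab cd.
have : rintable (fun u => k + w * (u - z)) a b c d.
  apply: ccont_rintable => // u _; apply: ccontD; first exact: ccont_cst.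
  by apply: ccontM; [exact: ccont_cst|apply: ccontB; [exact: ccont_id|exact: ccont_cst]].
move=> [h1 h2 h3 h4]; rewrite /rint.
set A := cint `[a, b] _; set B := cint `[c, d] _; set A' := cint `[a, b] _; set B' := cint `[c, d] _.
have -> : A + 'i * B - A' - 'i * B' = (A - A') + 'i * (B - B') by ring.
rewrite /A /A' /B /B' -!cintB//.
rewrite (_ : cint `[a, b] _ = cint `[a, b] (fun=> w * ('i * (c - d)%:C))); last first.
  apply: eq_cint => t _; rewrite opprD addrACA subrr add0r -mulrBr; congr (_ * _).
  have -> : (t +i* c) - z - ((t +i* d) - z) = (t +i* c) - (t +i* d) by ring.
  by simpc.
rewrite (_ : cint `[c, d] _ = cint `[c, d] (fun=> w * (b - a)%:C)); last first.
  apply: eq_cint => t _; rewrite opprD addrACA subrr add0r -mulrBr; congr (_ * _).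
  have -> : (b +i* t) - z - ((a +i* t) - z) = (b +i* t) - (a +i* t) by ring.
  by simpc.
by rewrite !itv_cint_cst// !rmorphB/=; ring.
Qed.

End Rectangles.
#[local] Arguments rint : simpl never.

(** * Goursat's theorem and the Cauchy formula *)

Section Goursat.
Variable R : realType.
Local Notation C := R[i].
Implicit Types (h : C -> C) (z w : C).

Lemma normc_rect (z w : C) (a b c d : R) : rect a b c d z -> rect a b c d w ->
  normc (z - w) <= (b - a) + (d - c).
Proof.
move=> /andP[/andP[? ?] /andP[? ?]] /andP[/andP[? ?] /andP[? ?]].
rewrite (le_trans (normc_le_ReIm _))// !raddfB /=.
by apply: lerD; rewrite ler_norml; apply/andP; split; lra.
Qed.

Lemma sub_rect (a b c d a' b' c' d' : R) : a <= a' -> b' <= b -> c <= c' -> d' <= d ->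
  rect a' b' c' d' `<=` rect a b c d.
Proof.
move=> aa bb cc dd z /andP[/andP[z1 z2] /andP[z3 z4]].
by rewrite /rect /= (le_trans aa z1) (le_trans z2 bb) (le_trans cc z3) (le_trans z4 dd).
Qed.

(** The integrals over the four quarters add up to the whole, since the inner sides cancel, so one
    quarter carries at least a fourth of the modulus. The witness [q] is its lower left corner. *)
Lemma rint_quarter h (x y l m : R) : 0 <= l -> 0 <= m ->
  (forall z, rect x (x + l * 2) y (y + m * 2) z -> ccont h z) ->
  exists q : R * R, [/\ x <= q.1 <= x + l, y <= q.2 <= y + m &
   normc (rint h x (x + l * 2) y (y + m * 2)) <=
     4 * normc (rint h q.1 (q.1 + l) q.2 (q.2 + m))].
Proof.
move=> l0 m0 ch.
have rh a b c d : a <= b -> c <= d -> x <= a -> b <= x + l * 2 -> y <= c -> d <= y + m * 2 ->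
    rintable h a b c d.
  move=> ? ? ? ? ? ?; apply: ccont_rintable => // z [/andP[/andP[? ?] /andP[? ?]] _].
  by apply: ch; rewrite /rect /=; apply/andP; split; apply/andP; split; lra.
have -> : x + l * 2 = x + l + l by lra.
have -> : y + m * 2 = y + m + m by lra.
rewrite (@rint_splitv _ h _ _ _ _ (x + l)); [|lra|by apply: rh; lra].
rewrite (@rint_splith _ h x _ _ _ (y + m)); [|lra|by apply: rh; lra].
rewrite (@rint_splith _ h (x + l) _ _ _ (y + m)); [|lra|by apply: rh; lra].
set I1 := rint h x _ y _; set I2 := rint h x _ (y + m) _.
set I3 := rint h (x + l) _ y _; set I4 := rint h (x + l) _ (y + m) _.
have le4 : normc (I1 + I2 + (I3 + I4)) <= normc I1 + normc I2 + (normc I3 + normc I4).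
  by rewrite (le_trans (le_normcD _ _))// lerD// le_normcD.
have xl : x <= x + l <= x + l /\ x <= x <= x + l by clear -l0; lra.
have ym : y <= y + m <= y + m /\ y <= y <= y + m by clear -m0; lra.
have [h1|h1] := leP (normc (I1 + I2 + (I3 + I4))) (4 * normc I1).
  by exists (x, y); split; [exact: xl.2|exact: ym.2|].
have [h2|h2] := leP (normc (I1 + I2 + (I3 + I4))) (4 * normc I2).
  by exists (x, y + m); split; [exact: xl.2|exact: ym.1|].
have [h3|h3] := leP (normc (I1 + I2 + (I3 + I4))) (4 * normc I3).
  by exists (x + l, y); split; [exact: xl.1|exact: ym.2|].
exists (x + l, y + m); split; [exact: xl.1|exact: ym.1|].
rewrite -/I4; clearbody I1 I2 I3 I4; clear -le4 h1 h2 h3; lra.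
Qed.

Lemma half_pow_lt (S r : R) : 0 < r -> exists k, S / 2 ^+ k < r.
Proof.
move=> r0; have [S0|S0] := leP S 0.
  by exists 0; rewrite expr0 divr1 (le_lt_trans S0).
exists (Num.truncn (S / r)).+1; rewrite ltr_pdivrMr ?exprn_gt0// mulrC -ltr_pdivrMr//.
apply: (lt_le_trans (truncnS_gt _)).
by rewrite -natrX ler_nat ltnW// ltn_expl.
Qed.

(** Repeated quartering shrinks to a point [z0], near which [h] is affine up to [e' * |z - z0|]. The
    factor [4 ^+ k] lost in the modulus is regained because the perimeter and the distance to [z0]
    are both of order [S / 2 ^+ k]. *)
Theorem goursat h (a b c d : R) : a <= b -> c <= d ->
  (forall z, rect a b c d z -> derivable h z 1) -> rint h a b c d = 0.
Proof.
move=> ab cd dh.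
pose L := b - a; pose H := d - c; pose S := L + H.
have L0 : 0 <= L by rewrite subr_ge0.
have H0 : 0 <= H by rewrite subr_ge0.
have p2 k : (0 : R) < 2 ^+ k by rewrite exprn_gt0.
pose I k (q : R * R) := rint h q.1 (q.1 + L / 2 ^+ k) q.2 (q.2 + H / 2 ^+ k).
pose valid k (q : R * R) := [/\ a <= q.1, q.1 + L / 2 ^+ k <= b, c <= q.2 & q.2 + H / 2 ^+ k <= d].
have hv (T : R) k : T / 2 ^+ k = T / 2 ^+ k.+1 * 2.
  by rewrite exprS; have := p2 k; set t := 2 ^+ k => t0; field; rewrite gt_eqF.
(* Validity is a premise after the existential, so that [choice] gives a total function [nxt]. *)
have step (kq : nat * (R * R)) : exists q' : R * R, valid kq.1 kq.2 ->
   [/\ valid kq.1.+1 q', kq.2.1 <= q'.1, kq.2.2 <= q'.2,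
     q'.1 + L / 2 ^+ kq.1.+1 <= kq.2.1 + L / 2 ^+ kq.1 /\
     q'.2 + H / 2 ^+ kq.1.+1 <= kq.2.2 + H / 2 ^+ kq.1 &
     normc (I kq.1 kq.2) <= 4 * normc (I kq.1.+1 q')].
  case: kq => k [x y] /=.
  have [[v1 v2 v3 v4]|nv] := pselect (valid k (x, y)); last by exists (x, y).
  have l0 : 0 <= L / 2 ^+ k.+1 by rewrite divr_ge0// ltW.
  have m0 : 0 <= H / 2 ^+ k.+1 by rewrite divr_ge0// ltW.
  move: v1 v2 v3 v4; rewrite /= /I /= !(hv L k) !(hv H k).
  set l := L / _ in l0 *; set m := H / _ in m0 * => v1 v2 v3 v4.
  have [z|q [/andP[q1 q2] /andP[q3 q4] q5]] := @rint_quarter h x y l m l0 m0.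
    by move=> /(sub_rect v1 v2 v3 v4)/dh; exact: ccont_derivable.
  by exists q => _; split=> //; split; rewrite /= -?/l -?/m; lra.
have [nxt Hn] := choice step.
pose u := fix u k := if k is k'.+1 then nxt (k', u k') else (a, c).
have uv k : valid k (u k).
  elim: k => [|k IH] /=; last by have [] := Hn (k, u k) IH.
  by rewrite /valid /= expr0 !divr1 /L /H; split; lra.
have uS k := Hn (k, u k) (uv k).
have u1 k m : (k <= m)%N -> (u k).1 <= (u m).1 /\ (u m).1 + L / 2 ^+ m <= (u k).1 + L / 2 ^+ k.
  elim: m => [|m IH]; first by rewrite leqn0 => /eqP ->.
  rewrite leq_eqVlt => /predU1P[-> //|/IH[i1 i2]].
  have [_ j1 _ [j2 _] _] := uS m; split; first exact: le_trans i1 j1.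
  exact: le_trans j2 i2.
have u2 k m : (k <= m)%N -> (u k).2 <= (u m).2 /\ (u m).2 + H / 2 ^+ m <= (u k).2 + H / 2 ^+ k.
  elim: m => [|m IH]; first by rewrite leqn0 => /eqP ->.
  rewrite leq_eqVlt => /predU1P[-> //|/IH[i1 i2]].
  have [_ _ j1 [_ j2] _] := uS m; split; first exact: le_trans i1 j1.
  exact: le_trans j2 i2.
have d0 (T : R) k : 0 <= T -> 0 <= T / 2 ^+ k by move=> T0; rewrite divr_ge0// ltW.
(* Nested intervals: the supremum of the lower ends lies in all of them. *)
have lim1 (T : R) (v : nat -> R) : 0 <= T ->
    (forall k m, (k <= m)%N -> v k <= v m /\ v m + T / 2 ^+ m <= v k + T / 2 ^+ k) ->
    exists x, forall k, v k <= x <= v k + T / 2 ^+ k.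
  move=> T0 vm; exists (sup (range v)) => k.
  have ubv : ubound (range v) (v k + T / 2 ^+ k).
    move=> _ [m _ <-]; have [km|/ltnW mk] := leqP k m.
      have [_ h2] := vm _ _ km; have := d0 T m T0; lra.
    have [h1 _] := vm _ _ mk; have := d0 T k T0; lra.
  apply/andP; split.
    apply: ub_le_sup; last by exists k.
    by exists (v k + T / 2 ^+ k).
  by apply: ge_sup => //; exists (v 0); exists 0.
have [x0 Hx0] := lim1 L (fun k => (u k).1) L0 u1.
have [y0 Hy0] := lim1 H (fun k => (u k).2) H0 u2.
pose z0 := x0 +i* y0.
have Rz0 : rect a b c d z0.
  have := Hx0 0; have := Hy0 0; rewrite /= expr0 !divr1 /L /H /rect /= => /andP[? ?] /andP[? ?].
  by apply/andP; split; apply/andP; split; lra.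
have Ik k : normc (I 0 (u 0)) <= 4 ^+ k * normc (I k (u k)).
  elim: k => [|k IH]; first by rewrite expr0 mul1r.
  have [_ _ _ _ j] := uS k; rewrite (le_trans IH)// exprSr -mulrA.
  by rewrite ler_pM2l// exprn_gt0.
have I0 : I 0 (u 0) = rint h a b c d.
  by rewrite /I /= expr0 !divr1 /L /H !addrA ![_ + _ - _]addrAC !subrr !add0r.
rewrite -I0; apply: normc_small0 => e e0.
have S0 : 0 <= S by rewrite addr_ge0.
(* The final bound is [e' * (4 * S ^+ 2)], which this choice keeps below [e]; the [+ 1] covers
   [S = 0]. *)
have e'0 : 0 < e / (4 * (S ^+ 2 + 1)).
  by apply: divr_gt0 e0 _; rewrite mulr_gt0// ltr_wpDl ?sqr_ge0.
have [r r0 Hr] := has_cderiv_derive1 (dh _ Rz0) e'0.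
set e' := e / _ in e'0 Hr; set D := derive1 h z0 in Hr.
have [k Hk] := half_pow_lt S r0.
apply: (le_trans (Ik k)).
have [v1 v2 v3 v4] := uv k.
have Rk z : rect (u k).1 ((u k).1 + L / 2 ^+ k) (u k).2 ((u k).2 + H / 2 ^+ k) z -> rect a b c d z.
  exact: sub_rect.
have Rz0k : rect (u k).1 ((u k).1 + L / 2 ^+ k) (u k).2 ((u k).2 + H / 2 ^+ k) z0.
  by rewrite /rect /=; apply/andP.
have lk : (u k).1 <= (u k).1 + L / 2 ^+ k by rewrite lerDl d0.
have mk : (u k).2 <= (u k).2 + H / 2 ^+ k by rewrite lerDl d0.
have ch z : rect a b c d z -> ccont h z by move=> /dh; exact: ccont_derivable.
have caff z : ccont (fun w => h z0 + D * (w - z0)) z.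
  apply: ccontD; first exact: ccont_cst.
  by apply: ccontM; [exact: ccont_cst|apply: ccontB; [exact: ccont_id|exact: ccont_cst]].
(* Subtracting the tangent map at [z0] does not change the integral, by [rint_affine]. *)
have -> : I k (u k) = rint (fun w => h w - (h z0 + D * (w - z0)))
    (u k).1 ((u k).1 + L / 2 ^+ k) (u k).2 ((u k).2 + H / 2 ^+ k).
  rewrite rintB; [by rewrite rint_affine// subr0| |].
  - by apply: ccont_rintable => // z /bdrect_rect/Rk/ch.
  - by apply: ccont_rintable => // z _; exact: caff.
have Sk : S / 2 ^+ k = (u k).1 + L / 2 ^+ k - (u k).1 + ((u k).2 + H / 2 ^+ k - (u k).2).
  by rewrite /S mulrDl; ring.
have bnd := @rint_bound R (fun w => h w - (h z0 + D * (w - z0))) (u k).1 ((u k).1 + L / 2 ^+ k)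
  (u k).2 ((u k).2 + H / 2 ^+ k) (e' * (S / 2 ^+ k)) lk mk.
rewrite -Sk in bnd.
apply: (@le_trans _ _ (4 ^+ k * (4 * (e' * (S / 2 ^+ k)) * (S / 2 ^+ k)))).
  rewrite ler_pM2l ?exprn_gt0//; apply: bnd.
  - by apply: ccont_rintable => // z /bdrect_rect/Rk/ch cz; apply: ccontB => //; exact: caff.
  - move=> z /bdrect_rect zk; rewrite opprD addrA.
    have zS : normc (z - z0) <= S / 2 ^+ k by rewrite Sk; exact: normc_rect.
    by rewrite (le_trans (Hr _ (le_lt_trans zS Hk)))// ler_pM2l.
have -> : 4 ^+ k * (4 * (e' * (S / 2 ^+ k)) * (S / 2 ^+ k)) = e' * (4 * S ^+ 2).
  have -> : (4 : R) ^+ k = 2 ^+ k * 2 ^+ k by rewrite -exprMn -natrM.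
  by have := p2 k; set t := 2 ^+ k => t0; field; rewrite gt_eqF.
rewrite /e' mulrAC ler_pdivrMr; last by rewrite mulr_gt0// ltr_wpDl ?sqr_ge0.
by rewrite ler_pM2l// ler_pM2l// lerDl.
Qed.

End Goursat.

Section CauchyFormula.
Variable R : realType.
Local Notation C := R[i].
Local Notation mu := (@lebesgue_measure R).
Implicit Types (h g : C -> C) (z w p : C).

Lemma derivable_sub_cst p z : derivable (fun w : C => w - p) z 1.
Proof. by apply: derivableB; [exact: derivable_id|exact: derivable_cst]. Qed.

Lemma derivable_div h g z : derivable h z 1 -> derivable g z 1 -> g z != 0 ->
  derivable (fun w => h w / g w) z 1.
Proof.
move=> dh dg g0; apply: (@derivableM _ _ h (fun w => (g w)^-1)); first exact: dh.
exact: derivableV.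
Qed.

Lemma derivable_div_sub h p z : derivable h z 1 -> z != p ->
  derivable (fun w => h w / (w - p)) z 1.
Proof.
move=> dh zp; apply: (derivable_div dh (@derivable_sub_cst _ _)).
by rewrite subr_eq0.
Qed.

Definition inside (a b c d : R) : set C :=
  [set z | (a < complex.Re z < b) && (c < complex.Im z < d)].

Lemma inside_rect a b c d z : inside a b c d z -> rect a b c d z.
Proof.
by move=> /andP[/andP[? ?] /andP[? ?]]; rewrite /rect/= !ltW.
Qed.

Lemma bdrect_neq a b c d z p : inside a b c d p -> bdrect a b c d z -> z != p.
Proof.
move=> /andP[/andP[p1 p2] /andP[p3 p4]] [_ zb]; apply/eqP => zp; move: zb; rewrite zp.
by rewrite !(gt_eqF p1, lt_eqF p2, gt_eqF p3, lt_eqF p4).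
Qed.

(** Here [h] may be singular at [p]. The part outside the square is cut into four rectangles that
    miss [p] (left, right, below, above), and Goursat's theorem annihilates each of them. *)
Lemma rint_shrink h (a b c d e : R) p : 0 < e ->
  a <= complex.Re p - e -> complex.Re p + e <= b ->
  c <= complex.Im p - e -> complex.Im p + e <= d ->
  (forall z, rect a b c d z -> z != p -> derivable h z 1) ->
  rint h a b c d = rint h (complex.Re p - e) (complex.Re p + e)
                          (complex.Im p - e) (complex.Im p + e).
Proof.
case: p => p1 p2 /= e0 ap bp cp dp H.
have rh a' b' c' d' : a <= a' -> b' <= b -> c <= c' -> d' <= d -> a' < p1 < b' -> c' < p2 < d' ->
    rintable h a' b' c' d'.
  move=> ? ? ? ? /andP[? ?] /andP[? ?]; apply: ccont_rintable; [lra|lra|].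
  move=> z zb; apply/ccont_derivable/H; last first.
    by apply: bdrect_neq zb; rewrite /inside /=; apply/andP; split; apply/andP; split.
  move/bdrect_rect : zb => /andP[/andP[? ?] /andP[? ?]].
  by rewrite /rect /=; apply/andP; split; apply/andP; split; lra.
have g0 a' b' c' d' : a <= a' -> a' <= b' -> b' <= b -> c <= c' -> c' <= d' -> d' <= d ->
    [|| p1 < a', b' < p1, p2 < c' | d' < p2] -> rint h a' b' c' d' = 0.
  move=> ? ? ? ? ? ? Hp; apply: goursat => // z /andP[/andP[z1 z2] /andP[z3 z4]]; apply: H.
    by rewrite /rect /=; apply/andP; split; apply/andP; split; lra.
  apply/eqP => zp; move: z1 z2 z3 z4; rewrite zp /= => z1 z2 z3 z4.
  by move: Hp; rewrite !ltNge z1 z2 z3 z4.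
rewrite (@rint_splitv _ h _ _ _ _ (p1 - e)); [|lra|by apply: rh; lra].
rewrite (@rint_splitv _ h (p1 - e) _ _ _ (p1 + e)); [|lra|by apply: rh; lra].
rewrite (@rint_splith _ h (p1 - e) _ _ _ (p2 - e)); [|lra|by apply: rh; lra].
rewrite (@rint_splith _ h (p1 - e) _ (p2 - e) _ (p2 + e)); [|lra|by apply: rh; lra].
rewrite [rint h a _ _ _]g0; [| lra..|by apply/or4P/Or42; lra].
rewrite [rint h (p1 + e) _ _ _]g0; [| lra..|by apply/or4P/Or41; lra].
rewrite [rint h _ _ c _]g0; [| lra..|by apply/or4P/Or44; lra].
rewrite [rint h _ _ (p2 + e) _]g0; [| lra..|by apply/or4P/Or43; lra].
by rewrite !addr0 !add0r.
Qed.

Lemma cint_real (A : set R) (f : R -> R) :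
  cint A (fun t => (f t)%:C) = (\int[mu]_(t in A) f t)%R%:C.
Proof.
rewrite /cint /=; congr (_ +i* _).
by rewrite /Rintegral integral0.
Qed.

Lemma continuous_lorentz (q e : R) : 0 < e ->
  continuous (fun t : R => 2 * e / ((t - q) ^+ 2 + e ^+ 2)).
Proof.
move=> e0 t; apply: cvgM; first exact: cvg_cst.
apply: cvgV; first by rewrite gt_eqF// ltr_wpDl ?sqr_ge0 ?exprn_gt0.
apply: cvgD; last exact: cvg_cst.
have c : (x - q) @[x --> t] --> t - q by apply: cvgB; [exact: cvg_id|exact: cvg_cst].
exact: (cvgM c c).
Qed.

(** An antiderivative is [2 * atan ((t - q) / e)], and [atan] is [pi / 4] at 1 and [- pi / 4] at
    -1. *)
Lemma integral_lorentz (q e : R) : 0 < e ->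
  (\int[mu]_(t in `[(q - e), (q + e)]) (2 * e / ((t - q) ^+ 2 + e ^+ 2)))%R = pi.
Proof.
move=> e0; have e1 : e != 0 by rewrite gt_eqF.
pose F (t : R) := 2 * atan ((t - q) / e).
have dF (t : R) : is_derive (t : R) (1 : R) F (2 * e / ((t - q) ^+ 2 + e ^+ 2)).
  have d1 : is_derive (t : R) (1 : R) (fun t : R => (t - q) / e) e^-1.
    have : is_derive (t : R) (1 : R) (fun t : R => e^-1 *: (t - q)) (e^-1 *: (1 - 0)) by apply: is_deriveZ.
    rewrite subr0 [_ *: 1]mulr1; congr (is_derive _ _ _ _).
    by apply/funext => x; rewrite -[_ *: _]/(_ * _) mulrC.
  have d2 := @is_derive1_comp _ (@atan R) (fun t : R => (t - q) / e) t _ _ (is_derive1_atan ((t - q) / e)) d1.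
  have d3 : is_derive (t : R) (1 : R) (fun t : R => 2 *: atan ((t - q) / e)) _ := is_deriveZ 2 d2.
  have -> : F = (fun t : R => 2 *: atan ((t - q) / e)) by [].
  apply: (is_derive_eq d3); rewrite -![_ *: _]/(_ * _).
  by field; rewrite e1 gt_eqF// ltr_wpDl ?sqr_ge0 ?exprn_gt0.
rewrite /Rintegral (@continuous_FTC2 _ _ F); last first.
- by move=> t _; rewrite derive1E; apply: derive_val.
- split.
  + by move=> t _; apply: ex_derive.
  + apply: cvg_at_right_filter; apply: differentiable_continuous.
    by apply/derivable1_diffP; apply: ex_derive.
  + apply: cvg_at_left_filter; apply: differentiable_continuous.
    by apply/derivable1_diffP; apply: ex_derive.
- by apply: continuous_subspaceT; exact: continuous_lorentz.
- by lra.
rewrite /F -EFinB /= (addrC q) addrK (addrC q) addrK mulNr divff// atanN atan1; lra.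
Qed.

(** Paired opposite sides have Lorentz kernels as integrands: [1/(z - p)] on the bottom minus the
    top is ['i] times the kernel, and on the right minus the left it is the kernel itself. Each pair
    contributes ['i * pi]. *)
Lemma rint_inv_sub_square p (e : R) : 0 < e ->
  rint (fun z => (z - p)^-1) (complex.Re p - e) (complex.Re p + e)
                             (complex.Im p - e) (complex.Im p + e) = two_pi_i R.
Proof.
case: p => p1 p2 /= e0.
have : rintable (fun z => (z - (p1 +i* p2))^-1) (p1 - e) (p1 + e) (p2 - e) (p2 + e).
  apply: ccont_rintable; [lra|lra|] => z zb; apply: ccont_derivable.
  apply: derivableV; last exact: derivable_sub_cst.
  rewrite subr_eq0; apply: bdrect_neq zb.
  by rewrite /inside /=; apply/andP; split; apply/andP; split; lra.
move=> [h1 h2 h3 h4]; rewrite /rint.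
have rearr (A B A' B' : C) : A + 'i * B - A' - 'i * B' = (A - A') + 'i * (B - B') by ring.
rewrite rearr -!cintB//.
have sq0 (x : R) : x ^+ 2 + e ^+ 2 != 0 by rewrite gt_eqF// ltr_wpDl ?sqr_ge0 ?exprn_gt0.
have inv_sub (A B : C) : A * B != 0 -> A^-1 - B^-1 = (B - A) / (A * B).
  by rewrite mulf_eq0 negb_or => /andP[? ?]; field; apply/andP.
have E1 : cint `[p1 - e, p1 + e] (fun x => ((x +i* (p2 - e)) - (p1 +i* p2))^-1 -
    ((x +i* (p2 + e)) - (p1 +i* p2))^-1) =
  'i * cint `[p1 - e, p1 + e] (fun t => (2 * e / ((t - p1) ^+ 2 + e ^+ 2))%:C).
  rewrite -cintZ//; last first.
    by split; apply: itv_integrable => t _ /=; [exact: continuous_lorentz|exact: cvg_cst].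
  apply: eq_cint => t _.
  have E : ((t +i* (p2 - e)) - (p1 +i* p2)) * ((t +i* (p2 + e)) - (p1 +i* p2)) =
      ((t - p1) ^+ 2 + e ^+ 2)%:C by simpc; congr (_ +i* _); ring.
  rewrite inv_sub E; last by rewrite fmorph_eq0.
  rewrite [(_ / _)%:C]fmorph_div mulrA; congr (_ / _).
  by simpc; congr (_ +i* _); ring.
have E2 : cint `[p2 - e, p2 + e] (fun x => (((p1 + e) +i* x) - (p1 +i* p2))^-1 -
    (((p1 - e) +i* x) - (p1 +i* p2))^-1) =
  cint `[p2 - e, p2 + e] (fun t => (2 * e / ((t - p2) ^+ 2 + e ^+ 2))%:C).
  apply: eq_cint => t _.
  have E : (((p1 + e) +i* t) - (p1 +i* p2)) * (((p1 - e) +i* t) - (p1 +i* p2)) =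
      - ((t - p2) ^+ 2 + e ^+ 2)%:C by simpc; congr (_ +i* _); ring.
  rewrite inv_sub E; last by rewrite oppr_eq0 fmorph_eq0.
  rewrite [(_ / _)%:C]fmorph_div invrN mulrN -mulNr; congr (_ / _).
  by simpc; congr (_ +i* _); ring.
rewrite E1 E2 !cint_real !integral_lorentz// /two_pi_i; simpc.
by congr (_ +i* _); ring.
Qed.

Lemma inside_square a b c d p : inside a b c d p -> exists2 r : R, 0 < r &
  forall e, 0 < e <= r -> [/\ a <= complex.Re p - e, complex.Re p + e <= b,
    c <= complex.Im p - e & complex.Im p + e <= d].
Proof.
move=> /andP[/andP[p1 p2] /andP[p3 p4]].
exists (Num.min (Num.min (complex.Re p - a) (b - complex.Re p))
                (Num.min (complex.Im p - c) (d - complex.Im p))).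
  by rewrite !lt_min !subr_gt0 p1 p2 p3.
by move=> e /andP[e0]; rewrite !le_min => /andP[/andP[? ?] /andP[? ?]]; split; lra.
Qed.

(** On a small square around [p], replacing [h z] by [h z - h p] leaves a difference quotient
    bounded by [|h'(p)| + 1], while the perimeter tends to 0. *)
Lemma cauchy_formula h a b c d p : inside a b c d p ->
  (forall z, rect a b c d z -> derivable h z 1) ->
  rint (fun z => h z / (z - p)) a b c d = two_pi_i R * h p.
Proof.
move=> ip dh; have [r r0 Hr] := inside_square ip.
have [s s0 Hs] := has_cderiv_derive1 (dh _ (inside_rect ip)) ltr01.
set D := derive1 h p in Hs; pose N := normc D + 1.
have N0 : 0 < N by rewrite ltr_wpDl// normc_ge0.
apply/eqP; rewrite -subr_eq0; apply/eqP; apply: normc_small0 => eps eps0.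
(* With half-side [e]: [r] keeps the square in the rectangle, [s / 8] keeps its points within
   [4 * e < s] of [p], and the last term makes the bound [16 * N * e] of [rint_bound] at most
   [eps]. *)
pose e := Num.min r (Num.min (s / 8) (eps / (16 * N))).
have e0 : 0 < e by rewrite !lt_min r0 !divr_gt0// mulr_gt0.
have er : e <= r by rewrite !ge_min lexx.
have es : e <= s / 8 by rewrite !ge_min lexx orbT.
have ee : e * (16 * N) <= eps by rewrite -ler_pdivlMr ?mulr_gt0// !ge_min lexx !orbT.
have [ap bp cp dp] := Hr e (introT andP (conj e0 er)).
rewrite (@rint_shrink _ _ _ _ _ _ p e0)//; last first.
  by move=> z zr zp; apply: derivable_div_sub zp; exact: dh.
have ipe : inside (complex.Re p - e) (complex.Re p + e) (complex.Im p - e) (complex.Im p + e) p.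
  by apply/andP; split; apply/andP; split; lra.
have rr z : rect (complex.Re p - e) (complex.Re p + e) (complex.Im p - e) (complex.Im p + e) z ->
   rect a b c d z.
  exact: sub_rect.
have l1 : complex.Re p - e <= complex.Re p + e by lra.
have l2 : complex.Im p - e <= complex.Im p + e by lra.
rewrite mulrC -(rint_inv_sub_square p e0) -rintZ; last first.
  apply: ccont_rintable => // z zb; apply: ccont_derivable.
  apply: derivableV; last exact: derivable_sub_cst.
  by rewrite subr_eq0; apply: bdrect_neq zb.
rewrite -rintB; last 2 first.
- apply: ccont_rintable => // z zb; apply: ccont_derivable.
  apply: derivable_div_sub; last exact: bdrect_neq zb.
  exact/dh/rr/bdrect_rect.
- apply: ccont_rintable => // z zb; apply: ccont_derivable.
  apply: derivable_div_sub; last exact: bdrect_neq zb.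
  exact: derivable_cst.
apply: (le_trans (@rint_bound _ _ _ _ _ _ N l1 l2 _ _)).
- apply: ccont_rintable => // z zb; apply: ccont_derivable; apply: derivableB.
    apply: derivable_div_sub; last exact: bdrect_neq zb.
    exact/dh/rr/bdrect_rect.
  apply: derivable_div_sub; last exact: bdrect_neq zb.
  exact: derivable_cst.
- move=> z zb; have zp := bdrect_neq ipe zb.
  rewrite -mulrBl normcM normcV ler_pdivrMr ?normc_gt0 ?subr_eq0//.
  have zps : normc (z - p) < s.
    rewrite (le_lt_trans (normc_rect (bdrect_rect zb) (inside_rect ipe)))//; lra.
  have := Hs _ zps; have := le_normcD (h z - h p - D * (z - p)) (D * (z - p)).
  rewrite subrK normcM mulrDl; lra.
- lra.
Qed.

End CauchyFormula.

(** * Cauchy-type integrals, analyticity of derivatives and of divided differences *)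

Section CauchyType.
Variable R : realType.
Local Notation C := R[i].
Implicit Types (h g phi : C -> C) (z w p : C) (a b c d : R).

Lemma has_cderiv_near h g z D (r : R) : 0 < r ->
  (forall w, normc (w - z) < r -> g w = h w) -> has_cderiv h z D -> has_cderiv g z D.
Proof.
move=> r0 gh H e e0; have [s s0 Hs] := H e e0.
exists (Num.min r s); first by rewrite lt_min r0.
move=> w; rewrite lt_min => /andP[wr ws]; rewrite !gh//; first exact: Hs.
by rewrite subrr normc_real normr0.
Qed.

Lemma has_cderivZ k h z D : has_cderiv h z D -> has_cderiv (fun w => k * h w) z (k * D).
Proof.
move=> H e e0; have k0 : 0 < normc k + 1 by rewrite ltr_wpDl// normc_ge0.
have [r r0 Hr] := H _ (divr_gt0 e0 k0); exists r => // w /Hr wr.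
have -> : k * h w - k * h z - k * D * (w - z) = k * (h w - h z - D * (w - z)) by ring.
rewrite normcM (le_trans (ler_wpM2l (normc_ge0 _) wr))//.
rewrite mulrA ler_wpM2r ?normc_ge0// mulrCA ger_pMr// ler_pdivrMr// mul1r lerDl//.
Qed.

Lemma pcont_bounded a b (F : R -> C) : a <= b -> (forall t, a <= t <= b -> pcont F t) ->
  exists M : R, forall t, a <= t <= b -> normc (F t) <= M.
Proof.
move=> ab cF.
have [|t0 _ Ht0] := @EVT_max R (fun t => `|complex.Re (F t)| + `|complex.Im (F t)|) a b ab.
  apply: continuous_in_subspaceT => t /set_mem; rewrite /= in_itv => /cF[c1 c2].
  by apply: cvgD; apply: cvg_norm.
exists (`|complex.Re (F t0)| + `|complex.Im (F t0)|) => t tab.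
by rewrite (le_trans (normc_le_ReIm _))// Ht0// in_itv.
Qed.

Lemma bdrect_bounded a b c d phi : a <= b -> c <= d ->
  (forall z, bdrect a b c d z -> ccont phi z) ->
  exists2 M : R, 0 < M & forall z, bdrect a b c d z -> normc (phi z) <= M.
Proof.
move=> ab cd cphi.
have [|M1 H1] := @pcont_bounded a b (fun t => phi (t +i* c)) ab.
  move=> t /andP[t1 t2]; apply: ccont_horizontal; apply: cphi.
  by rewrite /bdrect /rect /= t1 t2 cd eqxx !lexx ?orbT.
have [|M2 H2] := @pcont_bounded a b (fun t => phi (t +i* d)) ab.
  move=> t /andP[t1 t2]; apply: ccont_horizontal; apply: cphi.
  by rewrite /bdrect /rect /= t1 t2 cd eqxx !lexx ?orbT.
have [|M3 H3] := @pcont_bounded c d (fun t => phi (a +i* t)) cd.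
  move=> t /andP[t1 t2]; apply: ccont_vertical; apply: cphi.
  by rewrite /bdrect /rect /= t1 t2 ab eqxx !lexx ?orbT.
have [|M4 H4] := @pcont_bounded c d (fun t => phi (b +i* t)) cd.
  move=> t /andP[t1 t2]; apply: ccont_vertical; apply: cphi.
  by rewrite /bdrect /rect /= t1 t2 ab eqxx !lexx ?orbT.
exists (`|M1| + `|M2| + `|M3| + `|M4| + 1).
  by rewrite ltr_wpDl// !addr_ge0.
have := ler_norm M1; have := ler_norm M2; have := ler_norm M3; have := ler_norm M4.
have := normr_ge0 M1; have := normr_ge0 M2; have := normr_ge0 M3; have := normr_ge0 M4.
move=> ? ? ? ? ? ? ? ? [x y] [/andP[/= xab ycd]] /or4P[] /eqP /= E.
- by rewrite E; have := H3 _ ycd; lra.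
- by rewrite E; have := H4 _ ycd; lra.
- by rewrite E; have := H1 _ xab; lra.
- by rewrite E; have := H2 _ xab; lra.
Qed.

(** Differentiation under the integral sign. The quadratic remainder is uniform on the boundary, so
    its integral is at most a constant times [normc (w - z) ^+ 2], which is below
    [e * normc (w - z)] for [w] near [z]. *)
Lemma rint_cderiv (k : C -> C -> C) (k' : C -> C) z (r M : R) a b c d :
  a <= b -> c <= d -> 0 < r -> 0 <= M ->
  (forall w, normc (w - z) < r -> rintable (k^~ w) a b c d) ->
  rintable k' a b c d ->
  (forall u w, bdrect a b c d u -> normc (w - z) < r ->
     normc (k u w - k u z - k' u * (w - z)) <= M * normc (w - z) ^+ 2) ->
  has_cderiv (fun w => rint (k^~ w) a b c d) z (rint k' a b c d).
Proof.
move=> ab cd r0 M0 ik ik' H e e0.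
pose P := 4 * M * ((b - a) + (d - c)) + 1.
have P0 : 0 < P by rewrite ltr_wpDl// !mulr_ge0// addr_ge0// subr_ge0.
exists (Num.min r (e / P)); first by rewrite lt_min r0 divr_gt0.
move=> w; rewrite lt_min ltr_pdivlMr// => /andP[wr wP].
have zr : normc (z - z) < r by rewrite subrr normc_real normr0.
have ik'w : rintable (fun u => (w - z) * k' u) a b c d.
  by case: ik' => ? ? ? ?; split; exact: cintableZ.
have ikB : rintable (fun u => k u w - k u z) a b c d.
  by have [? ? ? ?] := ik _ wr; have [? ? ? ?] := ik _ zr; split; exact: cintableB.
rewrite (mulrC (rint k' _ _ _ _)) -rintZ// -rintB//; [|exact: ik|exact: ik].
rewrite -rintB//.
apply: le_trans (@rint_bound _ _ _ _ _ _ (M * normc (w - z) ^+ 2) ab cd _ _) _.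
- by case: ikB => ? ? ? ?; case: ik'w => ? ? ? ?; split; exact: cintableB.
- by move=> u ub; rewrite (mulrC (w - z)); exact: H.
- have n0 := normc_ge0 (w - z).
  have -> : 4 * (M * normc (w - z) ^+ 2) * (b - a + (d - c)) = (normc (w - z) * (P - 1)) * normc (w - z).
    by rewrite /P; ring.
  by apply: ler_wpM2r => //; lra.
Qed.

Lemma inside_dist a b c d p : inside a b c d p -> exists2 r : R, 0 < r &
  forall z, bdrect a b c d z -> r <= normc (z - p).
Proof.
move=> ip; have [r r0 Hr] := inside_square ip; exists r => // z [zr zb].
have [h1 h2 h3 h4] := Hr r (introT andP (conj r0 (lexx r))).
case/or4P: zb => /eqP E.
- by apply: le_trans (normc_Re _); rewrite raddfB /= E ler_normr; apply/orP; right; lra.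
- by apply: le_trans (normc_Re _); rewrite raddfB /= E ler_normr; apply/orP; left; lra.
- by apply: le_trans (normc_Im _); rewrite raddfB /= E ler_normr; apply/orP; right; lra.
- by apply: le_trans (normc_Im _); rewrite raddfB /= E ler_normr; apply/orP; left; lra.
Qed.

Lemma inside_near a b c d p : inside a b c d p -> exists2 r : R, 0 < r &
  forall w, normc (w - p) < r -> inside a b c d w.
Proof.
move=> ip; have [r r0 Hr] := inside_square ip; exists r => // w wr.
have [h1 h2 h3 h4] := Hr r (introT andP (conj r0 (lexx r))).
have := le_lt_trans (normc_Re _) wr; have := le_lt_trans (normc_Im _) wr.
rewrite !raddfB /= !ltr_norml => /andP[? ?] /andP[? ?].
by apply/andP; split; apply/andP; split; lra.
Qed.

Lemma derivable_exp h z k : derivable h z 1 -> derivable (fun w => h w ^+ k) z 1.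
Proof.
move=> dh; elim: k => [|k IH].
  by under eq_fun do rewrite expr0; exact: derivable_cst.
under eq_fun do rewrite exprS.
by apply: (@derivableM _ _ h (fun w => h w ^+ k)); [exact: dh|exact: IH].
Qed.

Lemma ccont_invX p z k : z != p -> ccont (fun w : C => ((w - p) ^+ k)^-1) z.
Proof.
move=> zp; apply: ccont_derivable; apply: derivableV.
  by rewrite expf_neq0// subr_eq0.
by apply: derivable_exp; exact: derivable_sub_cst.
Qed.

Lemma cauchy_rintable a b c d phi p k : a <= b -> c <= d -> inside a b c d p ->
  (forall z, bdrect a b c d z -> ccont phi z) ->
  rintable (fun u => phi u / (u - p) ^+ k) a b c d.
Proof.
move=> ab cd ip cphi; apply: ccont_rintable => // z zb.
by apply: ccontM; [exact: cphi|apply: ccont_invX; exact: bdrect_neq zb].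
Qed.

(** Taylor remainders of [1/(u - h)] and, below, of its square, with the factor [h ^+ 2] explicit as
    [rint_cderiv] requires. *)
Lemma inv_taylor1 (u h : C) : u != 0 -> u - h != 0 ->
  (u - h)^-1 - u^-1 - (u ^+ 2)^-1 * h = h ^+ 2 / ((u - h) * u ^+ 2).
Proof. by move=> u0 uh0; field; apply/andP. Qed.

Lemma inv_taylor2 (u h : C) : u != 0 -> u - h != 0 ->
  ((u - h) ^+ 2)^-1 - (u ^+ 2)^-1 - 2 / u ^+ 3 * h =
  h ^+ 2 * (3 / (u * (u - h)) ^+ 2 - 2 * h / (u ^+ 3 * (u - h) ^+ 2)).
Proof. by move=> u0 uh0; field; apply/andP. Qed.

(** Continuity of [phi] on the boundary is enough, since [w] occurs only in the kernel. With
    [phi = h], the first part gives Cauchy's formula for [h'] and the second makes [h'] derivable;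
    with [phi u = h u / (u - p)], the first part handles divided differences. *)
Lemma cauchy_type_cderiv a b c d phi p : a <= b -> c <= d -> inside a b c d p ->
  (forall z, bdrect a b c d z -> ccont phi z) ->
  has_cderiv (fun w => rint (fun u => phi u / (u - w)) a b c d) p
    (rint (fun u => phi u / (u - p) ^+ 2) a b c d) /\
  has_cderiv (fun w => rint (fun u => phi u / (u - w) ^+ 2) a b c d) p
    (rint (fun u => phi u * (2 / (u - p) ^+ 3)) a b c d).
Proof.
move=> ab cd ip cphi.
have [M M0 HM] := bdrect_bounded ab cd cphi.
have [r r0 Hr] := inside_dist ip; have [s s0 Hs] := inside_near ip.
(* [r] bounds the distance from [p] to the boundary from below, so [w] stays at distance at least
   [r / 2] from the boundary; [s] keeps it inside. *)
pose t := Num.min s (r / 2).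
have t0 : 0 < t by rewrite lt_min s0 divr_gt0.
have base u w : bdrect a b c d u -> normc (w - p) < t ->
   [/\ r <= normc (u - p), r / 2 <= normc (u - p - (w - p)), u - p != 0, u - p - (w - p) != 0 &
     normc (w - p) <= r / 2].
  move=> ub wt; have h1 := Hr _ ub.
  have h2 : normc (w - p) < r / 2 by rewrite (lt_le_trans wt)// ge_min lexx orbT.
  have h3 : r / 2 <= normc (u - p - (w - p)) by have := le_normc_sub (u - p) (w - p); lra.
  split; rewrite -?normc_gt0//; lra.
split.
- apply: (@rint_cderiv (fun u w => phi u / (u - w)) _ p t (M * ((r / 2)^-1 * (r ^+ 2)^-1))) => //.
  + by rewrite !mulr_ge0// ?invr_ge0 ?exprn_ge0 ?divr_ge0// ltW.
  + move=> w wt; have := @cauchy_rintable a b c d phi w 1 ab cd _ cphi; apply.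
    by apply: Hs; rewrite (lt_le_trans wt)// ge_min lexx.
  + exact: cauchy_rintable.
  + move=> u w ub wt; have [h1 h2 h3 h4 h5] := base u w ub wt.
    have -> : phi u / (u - w) - phi u / (u - p) - phi u / (u - p) ^+ 2 * (w - p) =
      phi u * ((w - p) ^+ 2 / ((u - p - (w - p)) * (u - p) ^+ 2)).
      rewrite -inv_taylor1//; have -> : u - p - (w - p) = u - w by ring.
      by ring.
    rewrite !(normcX, normcV, normcM) -mulrA [X in _ <= _ * X]mulrC.
    apply: ler_pM; [exact: normc_ge0| |exact: HM|].
      by rewrite !(mulr_ge0, exprn_ge0, invr_ge0, normc_ge0).
    rewrite ler_wpM2l ?exprn_ge0 ?normc_ge0// invfM ler_pM ?invr_ge0 ?exprn_ge0 ?normc_ge0//.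
      by rewrite lef_pV2 ?posrE//; lra.
    rewrite lef_pV2 ?posrE ?exprn_gt0//; last by lra.
    by rewrite ler_pXn2r ?nnegrE//; lra.
(* The constant bounds the remainder of [inv_taylor2] by means of [|u - p| >= r], [|u - w| >= r / 2]
   and [|w - p| <= r / 2]. *)
- apply: (@rint_cderiv (fun u w => phi u / (u - w) ^+ 2) _ p t
     (M * (3 * ((r * (r / 2)) ^+ 2)^-1 + 2 * (r / 2) * (r ^+ 3 * (r / 2) ^+ 2)^-1))) => //.
  + rewrite !mulr_ge0// ?ltW// addr_gt0// !(mulr_gt0, invr_gt0, exprn_gt0, divr_gt0)//.
  + move=> w wt; apply: cauchy_rintable => //.
    by apply: Hs; rewrite (lt_le_trans wt)// ge_min lexx.
  + have [i1 i2 i3 i4] := cauchy_rintable 3 ab cd ip cphi.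
    have -> : (fun u => phi u * (2 / (u - p) ^+ 3)) = (fun u => 2 * (phi u / (u - p) ^+ 3)).
      by apply/funext => u; rewrite mulrCA.
    by split; exact: cintableZ.
  + move=> u w ub wt; have [h1 h2 h3 h4 h5] := base u w ub wt.
    have -> : phi u / (u - w) ^+ 2 - phi u / (u - p) ^+ 2 - phi u * (2 / (u - p) ^+ 3) * (w - p) =
      phi u * (((w - p) ^+ 2) * (3 / ((u - p) * (u - p - (w - p))) ^+ 2 -
         2 * (w - p) / ((u - p) ^+ 3 * (u - p - (w - p)) ^+ 2))).
      rewrite -inv_taylor2//; have -> : u - p - (w - p) = u - w by ring.
      by ring.
    have up0 : 0 < normc (u - p) by rewrite normc_gt0.
    have uw0 : 0 < normc (u - p - (w - p)) by rewrite normc_gt0.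
    have r2 : 0 < r / 2 by rewrite divr_gt0.
    rewrite (normcM (phi u)) (normcM ((w - p) ^+ 2)) normcX -[leRHS]mulrA [X in _ <= M * X]mulrC.
    apply: ler_pM; [exact: normc_ge0| |exact: HM|].
      by rewrite !(mulr_ge0, exprn_ge0, normc_ge0).
    rewrite ler_wpM2l ?exprn_ge0 ?normc_ge0//.
    rewrite (le_trans (le_normcB _ _))// !(normcX, normcV, normcM).
    have n2 : normc (2 : C) = 2 by rewrite -(rmorph_nat (real_complex R)) normc_real normr_nat.
    have n3 : normc (3 : C) = 3 by rewrite -(rmorph_nat (real_complex R)) normc_real normr_nat.
    rewrite n2 n3; apply: lerD.
      rewrite ler_pM2l// lef_pV2 ?posrE ?exprn_gt0 ?mulr_gt0//.
      by apply: lerXn2r; rewrite ?nnegrE ?(mulr_ge0 (ltW up0) (ltW uw0)) ?(mulr_ge0 (ltW r0) (ltW r2))// ler_pM// ltW.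
    rewrite ler_pM ?mulr_ge0 ?invr_ge0 ?exprn_ge0 ?normc_ge0//.
    + by rewrite mulr_ge0// exprn_ge0// normc_ge0.
    + by rewrite ler_pM2l.
    + rewrite lef_pV2 ?posrE ?exprn_gt0 ?mulr_gt0 ?exprn_gt0//.
      by apply: ler_pM; rewrite ?exprn_ge0 ?(ltW r0) ?(ltW r2)//; apply: lerXn2r => //; rewrite nnegrE ltW.
Qed.

Lemma two_pi_i_neq0 : two_pi_i R != 0.
Proof. by rewrite eq_complex /= negb_and (gt_eqF (mulr_gt0 _ (pi_gt0 R))) ?orbT. Qed.

Section AnalyticInRect.
Variables (a b c d : R) (h : C -> C).
Hypothesis dh : forall z, rect a b c d z -> derivable h z 1.

Let cph z : bdrect a b c d z -> ccont h z.
Proof. by move=> /bdrect_rect/dh; exact: ccont_derivable. Qed.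

Let inside_le p : inside a b c d p -> a <= b /\ c <= d.
Proof. by move=> /andP[/andP[? ?] /andP[? ?]]; split; lra. Qed.

(** Near [p] the Cauchy integral of [h] coincides with [two_pi_i * h]; both sides are the derivative
    of this one function. *)
Lemma cauchy_formula_derive1 p : inside a b c d p ->
  rint (fun u => h u / (u - p) ^+ 2) a b c d = two_pi_i R * derive1 h p.
Proof.
move=> ip; have [ab cd] := inside_le ip.
have [H1 _] := cauchy_type_cderiv ab cd ip cph.
have [s s0 Hs] := inside_near ip.
rewrite -(derive1_cderiv H1).
apply: derive1_cderiv; apply: has_cderiv_near s0 _ _; last first.
  exact: has_cderivZ (has_cderiv_derive1 (dh (inside_rect ip))).
by move=> w /Hs iw; exact: cauchy_formula.
Qed.

Lemma derivable_derive1 p : inside a b c d p -> derivable (derive1 h) p 1.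
Proof.
move=> ip; have [ab cd] := inside_le ip.
have [_ H2] := cauchy_type_cderiv ab cd ip cph.
have [s s0 Hs] := inside_near ip.
apply/derivableP_cderiv; eexists.
apply: (has_cderiv_near s0 _ (has_cderivZ (two_pi_i R)^-1 H2)) => w /Hs iw.
by rewrite cauchy_formula_derive1// mulrA mulVf ?mul1r// two_pi_i_neq0.
Qed.

Definition divided_difference p z := if z == p then derive1 h p else (h z - h p) / (z - p).

(** Away from [p] this is a quotient. Near [p] it is a Cauchy-type integral divided by [two_pi_i],
    by the partial fractions of [1/((u - p) * (u - w))]; so the singularity is removable. *)
Lemma derivable_divided_difference p z : inside a b c d p -> inside a b c d z ->
  derivable (divided_difference p) z 1.
Proof.
move=> ip iz; have [ab cd] := inside_le ip.
have [zp|zp] := eqVneq z p; last first.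
  apply/derivableP_cderiv; exists (derive1 (fun w => (h w - h p) / (w - p)) z).
  have z0 : 0 < normc (z - p) by rewrite normc_gt0 subr_eq0.
  apply: has_cderiv_near z0 _ (has_cderiv_derive1 _); last first.
    apply: derivable_div_sub zp; apply: derivableB; last exact: derivable_cst.
    exact/dh/inside_rect.
  move=> w wz; rewrite /divided_difference; case: eqP => // wp.
  by move: wz; rewrite wp normcBC ltxx.
subst z.
(* The boundary density is [h u / (u - p)], continuous there because [p] is an interior point. *)
have cphi z : bdrect a b c d z -> ccont (fun u => h u / (u - p)) z.
  move=> zb; apply: ccontM; first exact: cph.
  by have := @ccont_invX p z 1; apply; exact: bdrect_neq zb.
have [H1 _] := cauchy_type_cderiv ab cd ip cphi.
have [s s0 Hs] := inside_near ip.
apply/derivableP_cderiv; eexists.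
apply: (has_cderiv_near s0 _ (has_cderivZ (two_pi_i R)^-1 H1)) => w /Hs iw.
rewrite /divided_difference; case: eqVneq => [->|wp].
  rewrite -[LHS]mul1r -(mulVf two_pi_i_neq0) -mulrA -cauchy_formula_derive1//.
  congr (_ * _); apply: eq_rint => // u ub; field.
  by rewrite subr_eq0; exact: bdrect_neq ub.
apply: (canRL (mulKf two_pi_i_neq0)).
rewrite mulrA mulrBr -(cauchy_formula iw dh) -(cauchy_formula ip dh) -rintB; last 2 first.
- by have := @cauchy_rintable _ _ _ _ _ w 1 ab cd iw cph.
- by have := @cauchy_rintable _ _ _ _ _ p 1 ab cd ip cph.
rewrite mulrC -rintZ; last first.
  have [i1 i2 i3 i4] := @cauchy_rintable _ _ _ _ _ w 1 ab cd iw cph.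
  have [j1 j2 j3 j4] := @cauchy_rintable _ _ _ _ _ p 1 ab cd ip cph.
  by split; exact: cintableB.
apply: eq_rint => // u ub; field.
by rewrite !subr_eq0 (bdrect_neq ip ub) (bdrect_neq iw ub).
Qed.

End AnalyticInRect.

End CauchyType.

(** * The argument principle *)

Section ArgumentPrinciple.
Variable R : realType.
Local Notation C := R[i].
Implicit Types (h g F : C -> C) (z w p : C) (a b c d delta : R).

(** The local results live on a rectangle; two points are needed because a divided difference
    involves both its base point and its argument. The height [y] is halfway between the larger
    [|Im|] and [delta]. *)
Lemma strip_rect delta z w : strip delta z -> strip delta w -> exists q : R * R * R * R,
  [/\ inside q.1.1.1 q.1.1.2 q.1.2 q.2 z, inside q.1.1.1 q.1.1.2 q.1.2 q.2 w &
      rect q.1.1.1 q.1.1.2 q.1.2 q.2 `<=` strip delta].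
Proof.
rewrite /strip /= => hz hw.
pose y := (Num.max `|complex.Im z| `|complex.Im w| + delta) / 2.
have y1 : `|complex.Im z| < y.
  have : `|complex.Im z| <= Num.max `|complex.Im z| `|complex.Im w| by rewrite le_max lexx.
  by rewrite /y; lra.
have y2 : `|complex.Im w| < y.
  have : `|complex.Im w| <= Num.max `|complex.Im z| `|complex.Im w| by rewrite le_max lexx orbT.
  by rewrite /y; lra.
have y3 : y < delta.
  have : Num.max `|complex.Im z| `|complex.Im w| < delta by rewrite gt_max hz.
  by rewrite /y; lra.
have [m1 m2] : Num.min (complex.Re z) (complex.Re w) <= complex.Re z /\
    Num.min (complex.Re z) (complex.Re w) <= complex.Re w by rewrite !ge_min !lexx orbT.
have [m3 m4] : complex.Re z <= Num.max (complex.Re z) (complex.Re w) /\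
    complex.Re w <= Num.max (complex.Re z) (complex.Re w) by rewrite !le_max !lexx orbT.
exists (Num.min (complex.Re z) (complex.Re w) - 1, Num.max (complex.Re z) (complex.Re w) + 1, - y, y).
move: y1 y2; rewrite !ltr_norml => /andP[? ?] /andP[? ?]; split => /=.
- by apply/andP; split; apply/andP; split; lra.
- by apply/andP; split; apply/andP; split; lra.
- by move=> u /andP[_ /andP[? ?]]; rewrite /strip /= ltr_norml; apply/andP; split; lra.
Qed.

Lemma analytic_derive1 delta h : analytic_on (strip delta) h ->
  analytic_on (strip delta) (derive1 h).
Proof.
move=> dh z zs; have [[[[a b] c] d] /= [iz _ rs]] := strip_rect zs zs.
by apply: derivable_derive1 iz => w /rs/dh.
Qed.

Lemma analytic_divided_difference delta h p : strip delta p ->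
  analytic_on (strip delta) h -> analytic_on (strip delta) (divided_difference h p).
Proof.
move=> ps dh z zs; have [[[[a b] c] d] /= [iz ip rs]] := strip_rect zs ps.
by apply: derivable_divided_difference ip iz => w /rs/dh.
Qed.

Lemma divided_differenceE h p z : h p = 0 -> h z = (z - p) * divided_difference h p z.
Proof.
move=> hp; rewrite /divided_difference; case: eqVneq => [->|zp].
  by rewrite subrr mul0r.
by rewrite hp subr0 mulrC divfK// subr_eq0.
Qed.

Lemma has_cderiv_subM g p z D : has_cderiv g z D -> ccont g z ->
  has_cderiv (fun w => (w - p) * g w) z (g z + (z - p) * D).
Proof.
move=> dg cg e e0.
have n0 : 0 < normc (z - p) + 1 by rewrite ltr_wpDl// normc_ge0.
have e1 : 0 < e / (2 * (normc (z - p) + 1)) by rewrite divr_gt0// mulr_gt0.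
have e2 : 0 < e / 2 by rewrite divr_gt0.
have [r r0 Hr] := dg _ e1; have [s s0 Hs] := cg _ e2.
exists (Num.min r s); first by rewrite lt_min r0.
move=> w; rewrite lt_min => /andP[/Hr wr /Hs ws].
have -> : (w - p) * g w - (z - p) * g z - (g z + (z - p) * D) * (w - z) =
  (z - p) * (g w - g z - D * (w - z)) + (g w - g z) * (w - z) by ring.
rewrite (le_trans (le_normcD _ _))// !normcM.
have := ler_wpM2r (normc_ge0 (w - z)) ws.
have := ler_wpM2l (normc_ge0 (z - p)) wr.
suff : normc (z - p) * (e / (2 * (normc (z - p) + 1)) * normc (w - z)) <= e / 2 * normc (w - z).
  by move=> ? ? ?; rewrite [e]splitr mulrDl; lra.
rewrite mulrA ler_wpM2r ?normc_ge0//.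
have -> : normc (z - p) * (e / (2 * (normc (z - p) + 1))) =
    e / 2 * (normc (z - p) / (normc (z - p) + 1)) by field; rewrite gt_eqF.
by rewrite ger_pMr// ler_pdivrMr// mul1r lerDl.
Qed.

Lemma derive1_divided_difference delta h p z : strip delta p -> strip delta z ->
  analytic_on (strip delta) h -> h p = 0 ->
  derive1 h z = divided_difference h p z + (z - p) * derive1 (divided_difference h p) z.
Proof.
move=> ps zs dh hp; have dd := analytic_divided_difference ps dh zs.
have := has_cderiv_subM p (has_cderiv_derive1 dd) (ccont_derivable dd).
rewrite (_ : (fun w => (w - p) * divided_difference h p w) = h); first exact: derive1_cderiv.
by apply/funext => w; rewrite -divided_differenceE.
Qed.

Lemma derivable_mul_logderiv delta h F z : strip delta z ->
  analytic_on (strip delta) h -> analytic_on (strip delta) F -> h z != 0 ->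
  derivable (fun w => F w * logderiv h w) z 1.
Proof.
move=> zs dh dF hz; apply: (@derivableM _ _ F (logderiv h)); first exact: dF.
by apply: derivable_div hz; [exact: (analytic_derive1 dh)|exact: dh].
Qed.

(** Induction on the zeros. From [h z = (z - p) * h1 z], the logarithmic derivative of [h] on the
    boundary is [1/(z - p)] plus that of [h1]; the first term gives [two_pi_i * F p] by Cauchy's
    formula. Without zeros, Goursat's theorem applies. *)
Theorem argument_principle delta a b c d h F (s : seq C) :
  a <= b -> - delta < c -> c <= d -> d < delta ->
  analytic_on (strip delta) h -> analytic_on (strip delta) F -> uniq s ->
  (forall z, z \in s -> inside a b c d z /\ derive1 h z != 0) ->
  (forall z, rect a b c d z -> h z = 0 <-> z \in s) ->
  rint (fun z => F z * logderiv h z) a b c d = two_pi_i R * \sum_(z <- s) F z.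
Proof.
move=> ab dc cd dd dh dF.
have rs z : rect a b c d z -> strip delta z.
  by move=> /andP[_ /andP[? ?]]; rewrite /strip /= ltr_norml; apply/andP; split; lra.
elim: s h dh => [|p s IH] h dh.
  move=> _ _ hz; rewrite big_nil mulr0; apply: goursat => // z zr.
  apply: derivable_mul_logderiv (rs _ zr) dh dF _.
  by apply/eqP => /(hz _ zr).
rewrite cons_uniq => /andP[ps us] hin hz.
have [ip dhp] := hin p (mem_head _ _).
have sp := rs _ (inside_rect ip).
have hp : h p = 0 by apply/(hz _ (inside_rect ip)); rewrite mem_head.
set h1 := divided_difference h p.
have dh1 : analytic_on (strip delta) h1 by exact: analytic_divided_difference.
have hE z : h z = (z - p) * h1 z by exact: divided_differenceE.
have dhE z : rect a b c d z -> derive1 h z = h1 z + (z - p) * derive1 h1 z.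
  by move=> zr; exact: (derive1_divided_difference sp (rs _ zr) dh hp).
have h1p : h1 p != 0 by rewrite /h1 /divided_difference eqxx.
have h1z z : rect a b c d z -> h1 z = 0 <-> z \in s.
  move=> zr; split=> [z0|zs].
    have : z \in p :: s by apply/(hz _ zr); rewrite hE z0 mulr0.
    by rewrite inE => /predU1P[zp|//]; move: h1p; rewrite -zp z0 eqxx.
  have : h z = 0 by apply/(hz _ zr); rewrite inE zs orbT.
  rewrite hE => /eqP; rewrite mulf_eq0 subr_eq0 => /predU1P[zp|/eqP//].
  by move: ps; rewrite -zp zs.
(* At a zero [z] of [h1], [h'(z) = (z - p) * h1'(z)], so the remaining zeros are still simple. *)
have h1in z : z \in s -> inside a b c d z /\ derive1 h1 z != 0.
  move=> zs; have zps : z \in p :: s by rewrite inE zs orbT.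
  have [iz dz] := hin z zps; split; first exact: iz.
  have zr := inside_rect iz.
  apply: contra dz => /eqP dz; rewrite dhE// dz mulr0 addr0.
  exact/eqP/h1z.
rewrite big_cons mulrDr -(IH h1 dh1 us h1in h1z) -(@cauchy_formula _ F a b c d p ip); last first.
  by move=> z /rs/dF.
(* All zeros lie strictly inside, so the boundary integrands have no poles. *)
have bdn z : bdrect a b c d z -> h1 z != 0.
  move=> zb; apply/eqP => /(h1z _ (bdrect_rect zb)) zs.
  by have [iz _] := h1in _ zs; have := bdrect_neq iz zb; rewrite eqxx.
rewrite -rintD; last 2 first.
- apply: ccont_rintable => // z zb; apply/ccont_derivable/derivable_div_sub.
    exact/dF/rs/bdrect_rect.
  exact: bdrect_neq zb.
- apply: ccont_rintable => // z zb; apply/ccont_derivable.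
  apply: derivable_mul_logderiv (rs _ (bdrect_rect zb)) dh1 dF _; exact: bdn.
apply: eq_rint => // z zb.
rewrite /logderiv dhE ?hE; last exact: bdrect_rect.
by field; rewrite subr_eq0 (bdrect_neq ip zb) bdn.
Qed.

End ArgumentPrinciple.

(** * Limits along an exhaustion of the real line *)

Section Limits.
Variable R : realType.
Local Notation C := R[i].
Local Notation mu := (@lebesgue_measure R).

Lemma integrable_inv_oneDsqr : mu.-integrable setT (EFin \o (fun x : R => (oneDsqr x)^-1)).
Proof.
have ge0 (x : R) : 0 <= (oneDsqr x)^-1 by rewrite invr_ge0 (le_trans ler01)// oneDsqr_ge1.
apply/integrableP; split.
  apply/measurable_EFinP; apply: continuous_measurable_fun.
  exact: continuous_oneDsqrV.
pose g (x : R) := (oneDsqr x)^-1.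
have -> : (\int[mu]_x `|(EFin \o (fun x : R => ((oneDsqr x)^-1)%R)) x| = \int[mu]_x (g x)%:E)%E.
  by apply: eq_integral => x _ /=; rewrite ger0_norm.
rewrite ge0_symfun_integralT//; last 2 first.
- exact: continuous_oneDsqrV.
- by move=> x; rewrite /g /= /oneDsqr sqrrN.
have -> : [set x : R | 0 <= x] = `[0, +oo[%classic by rewrite set_itvE.
by rewrite integral0y_oneDsqr; exact: ltry.
Qed.

Lemma cintable_decay (F : R -> C) (M : R) : (forall t : R, pcont F t) ->
  (forall t : R, M < `|t| -> t ^+ 2 * normc (F t) <= 1) -> cintable setT F.
Proof.
move=> cF dF; pose N := Num.max M 1.
have N1 : 1 <= N by rewrite le_max lexx orbT.
have NM : M <= N by rewrite le_max lexx.
have NN : - N <= N by lra.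
have [K HK] := @pcont_bounded R (- N) N F NN (fun t _ => cF t).
have K0 : 0 <= K by apply: le_trans (normc_ge0 (F 0)) (HK _ _); lra.
(* [L] dominates [(1 + t ^+ 2) * |F t|]: the first term for [|t| <= N], the 2 beyond, where
   [1 + t ^+ 2 <= 2 * t ^+ 2] because [N >= 1]. *)
pose L := K * (1 + N ^+ 2) + 2.
have L0 : 0 <= L by rewrite addr_ge0// mulr_ge0// addr_ge0// sqr_ge0.
have o0 (t : R) : 0 < oneDsqr t by rewrite (lt_le_trans ltr01)// oneDsqr_ge1.
have bnd (t : R) : normc (F t) <= L * (oneDsqr t)^-1.
  rewrite ler_pdivlMr// /oneDsqr; have n0 := normc_ge0 (F t).
  have [tN|tN] := leP `|t| N.
    have : normc (F t) <= K by apply: HK; rewrite -ler_norml.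
    have : t ^+ 2 <= N ^+ 2 by rewrite -real_normK ?num_real// lerXn2r// nnegrE; lra.
    rewrite /L; have := sqr_ge0 t; nra.
  have := dF t (le_lt_trans NM tN).
  have : 1 <= t ^+ 2 by rewrite -real_normK ?num_real// exprn_ege1//; lra.
  have : 0 <= K * (1 + N ^+ 2) by rewrite mulr_ge0// addr_ge0// sqr_ge0.
  rewrite /L; nra.
have key (f : R -> R) : continuous f -> (forall t, `|f t| <= normc (F t)) ->
    mu.-integrable setT (EFin \o f).
  move=> cf fF; have mT : measurable (setT : set (measurableTypeR R)) by exact: measurableT.
  apply: le_integrable (integrableZl mT L integrable_inv_oneDsqr) => //.
    by apply/measurable_EFinP; exact: continuous_measurable_fun.
  move=> t _ /=; rewrite lee_fin (ger0_norm (le_trans (normc_ge0 _) (bnd t))).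
  exact: le_trans (fF t) (bnd t).
by split; apply: key => t; [have [] := cF t|exact: normc_Re|have [] := cF t|exact: normc_Im].
Qed.

(** Dominated convergence. The endpoints are left free beyond [- k] and [k], since the vertical
    sides of the rectangles must be moved off the discs. *)
Lemma Rintegral_itv_cvg (f : R -> R) (A B : nat -> R) :
  (forall k, A k <= - k%:R) -> (forall k, k%:R <= B k) ->
  mu.-integrable setT (EFin \o f) ->
  (\int[mu]_(t in `[A k, B k]) f t)%R @[k --> \oo] --> (\int[mu]_t f t)%R.
Proof.
move=> HA HB fi.
have fin : (\int[mu]_t (f t)%:E)%E \is a fin_num by exact: integrable_fin_num fi.
rewrite /Rintegral; apply: fine_cvg; rewrite fineK//.
have -> : (fun k => \int[mu]_(t in `[A k, B k]) (f t)%:E)%E =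
    (fun k => \int[mu]_t ((EFin \o f) \_ `[A k, B k]) t)%E.
  by apply/funext => k; rewrite integral_mkcond.
have mT : measurable (setT : set (measurableTypeR R)) by exact: measurableT.
have /integrableP[mf _] := fi.
apply: (dominated_cvg mT (g := fun t => `|(f t)%:E|%E)).
- move=> k; apply/measurable_restrict => //; exact: measurable_funS mf.
- move=> t _; apply: cvg_near_cst; near=> k.
  rewrite patchE ifT// inE /= in_itv /=.
  have kt : `|t| <= k%:R by near: k; exact: nbhs_infty_ger.
  by rewrite (le_trans (HA k)) ?(le_trans _ (HB k))//; move: kt; rewrite ler_norml => /andP[].
- by [].
- exact: integrable_abse fi.
- by move=> k t _; rewrite patchE; case: ifP => // _; rewrite abse0.
Unshelve. all: by end_near.
Qed.

Lemma cvg_ReIm (u : nat -> C) (l : C) :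
  (fun k => complex.Re (u k)) @ \oo --> complex.Re l ->
  (fun k => complex.Im (u k)) @ \oo --> complex.Im l -> u @ \oo --> l.
Proof.
move=> /cvgrPdist_lt u1 /cvgrPdist_lt u2; apply/cvgrPdist_lt => -[e e'].
rewrite ltcE /= => /andP[/eqP -> e0].
have e20 : 0 < e / 2 by rewrite divr_gt0.
near=> k; rewrite -[_ < _]/(_ < e%:C) ltcR (le_lt_trans (normc_le_ReIm _))// !raddfB /= [e]splitr.
by apply: ltrD; near: k; [exact: u1|exact: u2].
Unshelve. all: by end_near.
Qed.

Lemma cint_itv_cvg (F : R -> C) (A B : nat -> R) :
  (forall k, A k <= - k%:R) -> (forall k, k%:R <= B k) -> cintable setT F ->
  cint `[A k, B k] F @[k --> \oo] --> cint setT F.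
Proof.
move=> HA HB [F1 F2]; apply: cvg_ReIm; rewrite /cint /=; exact: Rintegral_itv_cvg.
Qed.

Lemma cvgc0 (u : nat -> C) : (forall e : R, 0 < e -> exists N, forall k, (N <= k)%N -> normc (u k) <= e) ->
  u @ \oo --> (0 : C).
Proof.
move=> H; apply/cvgrPdist_le => -[e e'].
rewrite ltcE /= => /andP[/eqP -> e0]; have [N HN] := H _ e0.
exists N => // k /= /HN uk; rewrite sub0r normrN -[_ <= _]/(_ <= e%:C) lecR //.
Qed.

(** A finite subset [X] of [D] already sums to within [e] of the total. Once the interval contains
    [X], nonnegativity puts its sum between that of [X] and the total. *)
Lemma sum_cvg_esum (D : set R) (a : R -> R) (A B : nat -> R) :
  (forall k, A k <= - k%:R) -> (forall k, k%:R <= B k) ->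
  (forall k, finite_set (D `&` `[A k, B k])) ->
  (forall x, 0 <= a x) -> (esum D (EFin \o a) < +oo)%E ->
  \sum_(x <- finmap.enum_fset (fset_set (D `&` `[A k, B k]))) a x @[k --> \oo]
    --> fine (esum D (EFin \o a)).
Proof.
move=> HA HB fD a0 Hfin.
have fn : esum D (EFin \o a) \is a fin_num.
  by rewrite ge0_fin_numE// esum_ge0// => x _; rewrite lee_fin.
have sumE (X : set R) : finite_set X ->
    (\sum_(x \in X) (EFin \o a) x = (\sum_(x <- finmap.enum_fset (fset_set X)) a x)%:E)%E.
  by move=> fX; rewrite fsbig_finite//= sumEFin.
have sub_le (X Y : set R) : finite_set X -> finite_set Y -> X `<=` Y ->
    \sum_(x <- finmap.enum_fset (fset_set X)) a x <= \sum_(x <- finmap.enum_fset (fset_set Y)) a x.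
  move=> fX fY XY; rewrite -lee_fin -!sumE//.
  rewrite -!esum_fset//; try by move=> i _; rewrite lee_fin.
  apply: ub_ereal_sup => _ [Z [fZ ZX] <-]; apply: esum_ge; exists Z => //.
  by split=> //; exact: subset_trans ZX XY.
apply/cvgrPdist_le => e e0.
have [_ [X [fX XD] <-] ] := ub_ereal_sup_adherent e0 fn.
rewrite sumE// -/(esum _ _) -{1}(fineK fn) -EFinB lte_fin => HX.
have [M HM] : exists M : R, forall x, X x -> `|x| <= M.
  exists (\sum_(x <- finmap.enum_fset (fset_set X)) `|x|) => x Xx.
  have xin : x \in finmap.enum_fset (fset_set X).
    by have := in_fset_set fX x; rewrite (mem_set Xx).
  by rewrite (big_rem x)//= lerDl sumr_ge0.
near=> k.
have kM : M <= k%:R by near: k; exact: nbhs_infty_ger.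
have h1 : \sum_(x <- finmap.enum_fset (fset_set (D `&` `[A k, B k]))) a x <= fine (esum D (EFin \o a)).
  have fs : fsets D (D `&` `[A k, B k]) by split; [exact: fD|move=> x []].
  rewrite -lee_fin fineK// -(sumE _ (fD k)); apply: esum_ge.
  by exists (D `&` `[A k, B k]).
have h2 : \sum_(x <- finmap.enum_fset (fset_set X)) a x <=
    \sum_(x <- finmap.enum_fset (fset_set (D `&` `[A k, B k]))) a x.
  apply: sub_le => // x Xx; split; first exact: XD.
  have := HM _ Xx; rewrite /= in_itv /= ler_norml => /andP[x1 x2].
  by have := HA k; have := HB k; move=> ? ?; apply/andP; split; lra.
by rewrite ger0_norm ?subr_ge0//; lra.
Unshelve. all: by end_near.
Qed.

Lemma sum_cvg_dsum (D : set R) (a : R -> R) (A B : nat -> R) :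
  (forall k, A k <= - k%:R) -> (forall k, k%:R <= B k) ->
  (forall k, finite_set (D `&` `[A k, B k])) -> summable D (EFin \o a) ->
  \sum_(x <- finmap.enum_fset (fset_set (D `&` `[A k, B k]))) a x @[k --> \oo] --> dsum D a.
Proof.
move=> HA HB fD sa.
pose ap x := Num.max (a x) 0; pose an x := Num.max (- a x) 0.
have apE : (EFin \o a)^\+%E = EFin \o ap.
  by apply/funext => x; rewrite /ap funeposE /= EFin_max.
have anE : (EFin \o a)^\-%E = EFin \o an.
  by apply/funext => x; rewrite /an funenegE /= EFin_max.
have ap0 x : 0 <= ap x by rewrite /ap le_max lexx orbT.
have an0 x : 0 <= an x by rewrite /an le_max lexx orbT.
have fp : (esum D (EFin \o ap) < +oo)%E.
  apply: le_lt_trans sa; apply: le_esum => x _ /=.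
  by rewrite lee_fin /ap ge_max ler_norm normr_ge0.
have fn : (esum D (EFin \o an) < +oo)%E.
  apply: le_lt_trans sa; apply: le_esum => x _ /=.
  by rewrite lee_fin /an ge_max normr_ge0 andbT -normrN ler_norm.
have -> : dsum D a = fine (esum D (EFin \o ap)) - fine (esum D (EFin \o an)).
  rewrite /dsum apE anE fineB// ge0_fin_numE// esum_ge0// => x _; rewrite lee_fin //.
have -> : (fun k => \sum_(x <- finmap.enum_fset (fset_set (D `&` `[A k, B k]))) a x) =
  (fun k => \sum_(x <- finmap.enum_fset (fset_set (D `&` `[A k, B k]))) ap x -
            \sum_(x <- finmap.enum_fset (fset_set (D `&` `[A k, B k]))) an x).
  apply/funext => k; rewrite -sumrB; apply: eq_bigr => x _.
  by rewrite /ap /an; case: (leP 0 (a x)) => h; rewrite /Num.max; do !case: ifPn; lra.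
by apply: cvgB; exact: sum_cvg_esum.
Qed.

(** Bolzano-Weierstrass: an infinite bounded subset of [D] would have a limit point. *)
Lemma finite_discrete (D : set R) (a b : R) : limit_point D = set0 ->
  finite_set (D `&` `[a, b]).
Proof.
move=> D0; apply: contrapT => inf.
have bd : bounded_set (D `&` `[a, b]).
  exists (`|a| + `|b|); split; first exact: num_real.
  move=> M HM x [_ /=]; rewrite in_itv /= => /andP[ax xb].
  rewrite ler_norml; have := ler_norm b; have := ler_norm (- a); rewrite normrN.
  by have := normr_ge0 a; have := normr_ge0 b; move=> ? ? ? ?; apply/andP; split; lra.
have [x Hx] := infinite_bounded_limit_point_nonempty inf bd.
have : limit_point D x.
  by move=> U /Hx[y [? [? _] ?]]; exists y.
by rewrite D0.
Qed.

End Limits.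

(** * The contour quadrature formula *)

Section StripQuadrature.
Variable R : realType.
Local Notation C := R[i].
Local Notation mu := (@lebesgue_measure R).

(** For such [t] the whole vertical line over [t] stays outside the open discs. *)
Definition uncovered (D : set R) (r : R -> R) (t : R) := forall x, D x -> r x <= `|x - t|.

(* The discs being disjoint, an end of the projection of a disc to the real axis
   is in no such projection: vertical lines through it avoid all the discs. *)
Lemma uncovered_endpoint (D : set R) (r : R -> R) (x t : R) :
  (forall x y, D x -> D y -> x != y -> r x + r y <= `|x - y|) ->
  D x -> `|x - t| = r x -> uncovered D r t.
Proof.
move=> sep Dx xt y Dy; have [->|yx] := eqVneq y x; first by rewrite xt.
have := sep y x Dy Dx yx; have := ler_distD t y x.
by rewrite -(distrC x t) xt; lra.
Qed.

(** If [T] is covered by the disc at [x], then the right end [x + r x] of its projection lies beyond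
    [T] and is uncovered. *)
Lemma uncovered_right (D : set R) (r : R -> R) : (forall x, D x -> 0 < r x) ->
  (forall x y, D x -> D y -> x != y -> r x + r y <= `|x - y|) ->
  forall T : R, exists2 t, T <= t & uncovered D r t.
Proof.
move=> r0 sep T; have [cT|] := pselect (uncovered D r T); first by exists T.
move=> /existsNP[x /not_implyP[Dx /negP]]; rewrite -ltNge => xT.
exists (x + r x); first by move: xT; rewrite ltr_norml => /andP[]; lra.
apply: (uncovered_endpoint sep Dx); rewrite opprD addrA subrr sub0r normrN gtr0_norm//.
exact: r0.
Qed.

Lemma uncovered_left (D : set R) (r : R -> R) : (forall x, D x -> 0 < r x) ->
  (forall x y, D x -> D y -> x != y -> r x + r y <= `|x - y|) ->
  forall T : R, exists2 t, t <= T & uncovered D r t.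
Proof.
move=> r0 sep T; have [cT|] := pselect (uncovered D r T); first by exists T.
move=> /existsNP[x /not_implyP[Dx /negP]]; rewrite -ltNge => xT.
exists (x - r x); first by move: xT; rewrite ltr_norml => /andP[]; lra.
apply: (uncovered_endpoint sep Dx); rewrite opprB addrC subrK gtr0_norm//.
exact: r0.
Qed.

(** The vertical sides have fixed length and carry a uniformly small integrand, so only the
    horizontal lines survive, the lower one with sign plus. *)
Lemma rint_limit (h : C -> C) (y1 y2 : R) (A B : nat -> R) : y1 <= y2 ->
  (forall k, A k <= - k%:R) -> (forall k, k%:R <= B k) ->
  cintable setT (fun t => h (t +i* y1)) -> cintable setT (fun t => h (t +i* y2)) ->
  (forall k s, y1 <= s <= y2 -> ccont h (A k +i* s) /\ ccont h (B k +i* s)) ->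
  (forall e, 0 < e -> exists N, forall k s, (N <= k)%N -> y1 <= s <= y2 ->
      normc (h (A k +i* s)) <= e /\ normc (h (B k +i* s)) <= e) ->
  rint h (A k) (B k) y1 y2 @[k --> \oo] -->
    cint setT (fun t => h (t +i* y1)) - cint setT (fun t => h (t +i* y2)).
Proof.
move=> y12 HA HB i1 i2 ch dh.
have vert (E : nat -> R) : (forall k s, y1 <= s <= y2 -> ccont h (E k +i* s)) ->
    (forall e, 0 < e -> exists N, forall k s, (N <= k)%N -> y1 <= s <= y2 ->
      normc (h (E k +i* s)) <= e) ->
    'i * cint `[y1, y2] (fun s => h (E k +i* s)) @[k --> \oo] --> (0 : C).
  move=> cE dE; apply: cvgc0 => e e0.
  (* The 2 is that of [itv_cint_bound]; the 1 allows [y1 = y2]. *)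
  have y0 : 0 < 2 * (y2 - y1) + 1 by lra.
  have [N HN] := dE _ (divr_gt0 e0 y0); exists N => k Nk.
  rewrite normcM normc_i mul1r.
  apply: le_trans (itv_cint_bound y12 _ (fun s ys => HN k s Nk ys)) _.
    by apply: itv_cintable => s ys; apply: ccont_vertical; exact: cE.
  have -> : 2 * (e / (2 * (y2 - y1) + 1)) * (y2 - y1) =
    e * (2 * (y2 - y1) / (2 * (y2 - y1) + 1)) by field; rewrite gt_eqF.
  rewrite ger_pMr// ler_pdivrMr//; lra.
have -> : cint setT (fun t => h (t +i* y1)) - cint setT (fun t => h (t +i* y2)) =
    cint setT (fun t => h (t +i* y1)) + 0 - cint setT (fun t => h (t +i* y2)) - 0.
  by rewrite addr0 subr0.
have vA : 'i * cint `[y1, y2] (fun s => h (A k +i* s)) @[k --> \oo] --> (0 : C).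
  apply: vert => [k s ys|e /dh[N HN]]; first by have [] := ch k s ys.
  by exists N => k s Nk ys; have [] := HN k s Nk ys.
have vB : 'i * cint `[y1, y2] (fun s => h (B k +i* s)) @[k --> \oo] --> (0 : C).
  apply: vert => [k s ys|e /dh[N HN]]; first by have [] := ch k s ys.
  by exists N => k s Nk ys; have [] := HN k s Nk ys.
have c1 := cint_itv_cvg HA HB i1; have c2 := cint_itv_cvg HA HB i2.
exact: (cvgB (cvgB (cvgD c1 vB) c2) vA).
Qed.

Lemma nat_ge (M : R) : exists N : nat, forall k, (N <= k)%N -> M < k%:R.
Proof.
exists (Num.truncn M).+1 => k Nk; rewrite (lt_le_trans (truncnS_gt M))// ler_nat //.
Qed.

Variables (delta : R) (D : set R) (f b gamma : C -> C) (m : nat).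
Hypothesis delta_gt0 : 0 < delta.
Hypothesis D_discrete : limit_point D = set0.
Hypothesis f_analytic : analytic_on (strip delta) f.
Hypothesis f_ge0 : forall x : R, 0 <= f x%:C.
Hypothesis b_analytic : analytic_on (strip delta) b.
Hypothesis b_ge0 : forall x : R, 0 <= b x%:C.
Hypothesis fb_decay : forall k : nat,
  vanishes_at_infty (strip delta) (fun z => normc z)
    (fun z => normc z ^+ k * normc (f z * b z)).
Hypothesis gamma_analytic : analytic_on (strip delta) gamma.
Hypothesis gamma_zeros : vanishes_exactly_on (strip delta) gamma D.
Hypothesis gamma_simple : forall x : R, D x -> derive1 gamma x%:C != 0.
Hypothesis gamma_decay : logderiv_decay delta D f gamma.
Hypothesis f_summable : summable D (fun x => (x ^+ m * on_real f x)%:E).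

Local Notation eta := (delta / 2).
Let F (z : C) := z ^+ m * f z.
Let G (z : C) := F z * logderiv gamma z.
Let H (z : C) := z ^+ m * (f z * b z).

Let eta_gt0 : 0 < eta. Proof. by rewrite divr_gt0. Qed.

Lemma strip_line t y : `|y| <= eta -> strip delta (t +i* y).
Proof. by move=> yd; rewrite /strip /=; have := delta_gt0; lra. Qed.

Lemma analytic_expM (h : C -> C) k : analytic_on (strip delta) h ->
  analytic_on (strip delta) (fun z => z ^+ k * h z).
Proof.
move=> dh z zs; apply: (@derivableM _ _ (fun z : C => z ^+ k) h); last exact: dh.
by apply: derivable_exp; exact: derivable_id.
Qed.

Let F_analytic : analytic_on (strip delta) F. Proof. exact: analytic_expM. Qed.

Let H_analytic : analytic_on (strip delta) H.
Proof.
apply: analytic_expM => z zs.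
by apply: (@derivableM _ _ f b); [exact: f_analytic|exact: b_analytic].
Qed.

(** Two powers beyond [m] give the decay [1/t^2], because [|t| <= normc (t +i* y)]. *)
Lemma H_cintable y : `|y| <= eta -> cintable setT (fun t => H (t +i* y)).
Proof.
move=> yd; have [M HM] := fb_decay (m + 2) ltr01.
apply: (@cintable_decay _ _ M) => [t|t Mt].
  by apply/ccont_horizontal/ccont_derivable/H_analytic; exact: strip_line.
have tz : `|t| <= normc (t +i* y) := normc_Re (t +i* y).
have := HM _ (strip_line t yd) (lt_le_trans Mt tz).
rewrite ger0_norm ?mulr_ge0 ?exprn_ge0 ?normc_ge0// => /ltW; apply: le_trans.
rewrite /H normcM normcX exprD mulrA -(mulrC (normc _ ^+ m)) ler_wpM2r ?normc_ge0//.
rewrite ler_wpM2l ?exprn_ge0 ?normc_ge0// -real_normK ?num_real//.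
by rewrite lerXn2r// nnegrE// normc_ge0.
Qed.

(** [H] has no poles in the strip: its rectangle integrals vanish, and so does their limit, the
    difference of the two line integrals. *)
Lemma H_shift y1 y2 : - eta <= y1 -> y1 <= y2 -> y2 <= eta ->
  cint setT (fun t => H (t +i* y1)) = cint setT (fun t => H (t +i* y2)).
Proof.
move=> ? y12 ?.
have yd s : y1 <= s <= y2 -> `|s| <= eta.
  by move=> /andP[? ?]; rewrite ler_norml; apply/andP; split; lra.
have h1 : `|y1| <= eta by apply: yd; rewrite lexx.
have h2 : `|y2| <= eta by apply: yd; rewrite y12 lexx.
have cH t s : y1 <= s <= y2 -> ccont H (t +i* s).
  by move=> ys; apply/ccont_derivable/H_analytic; exact/strip_line/yd.
have L : rint H (- k%:R) k%:R y1 y2 @[k --> \oo] -->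
    cint setT (fun t => H (t +i* y1)) - cint setT (fun t => H (t +i* y2)).
  apply: (@rint_limit _ y1 y2 (fun k => - k%:R) (fun k => k%:R)) => //.
  - exact: H_cintable.
  - exact: H_cintable.
  - by move=> k s ys; split; exact: cH.
  - move=> e e0; have [M HM] := fb_decay m e0; have [N HN] := nat_ge M.
    exists N => k s Nk ys; rewrite /H !normcM !normcX.
    have kM := HN _ Nk; have k0 : 0 <= k%:R :> R by [].
    have s1 := HM ((- k%:R) +i* s) (strip_line _ (yd _ ys)).
    have s2 := HM (k%:R +i* s) (strip_line _ (yd _ ys)).
    have n1 := normc_Re ((- k%:R) +i* s); have n2 := normc_Re (k%:R +i* s).
    rewrite /= normrN ger0_norm// in n1; rewrite /= ger0_norm// in n2.
    have := s1 (lt_le_trans kM n1); have := s2 (lt_le_trans kM n2).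
    by rewrite !ger0_norm ?mulr_ge0 ?exprn_ge0 ?normc_ge0// !normcM => /ltW ? /ltW ?.
have L0 : (fun k : nat => rint H (- k%:R) k%:R y1 y2) = (fun=> 0).
  apply/funext => k; apply: goursat; [|exact: y12|].
    by rewrite (@le_trans _ _ 0)// oppr_le0.
  by move=> [x y] /andP[_ /= ys]; apply/H_analytic/strip_line/yd.
rewrite L0 in L.
by apply/eqP; rewrite -subr_eq0; apply/eqP; exact: (cvg_unique (@norm_hausdorff _ _) L (cvg_cst _)).
Qed.

(** In the order of [R[i]], being nonnegative includes having imaginary part 0. *)
Lemma f_real x : f x%:C = (on_real f x)%:C.
Proof. by have := f_ge0 x; rewrite lecE /on_real; case: (f _) => u v /= /andP[/eqP -> _]. Qed.

Lemma b_real x : b x%:C = (on_real b x)%:C.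
Proof. by have := b_ge0 x; rewrite lecE /on_real; case: (b _) => u v /= /andP[/eqP -> _]. Qed.

Lemma H_line y : `|y| <= eta -> cint setT (fun t => H (t +i* y)) =
  (\int[mu]_x (x ^+ m * (on_real f x * on_real b x)))%R%:C.
Proof.
move=> yd; have -> : cint setT (fun t => H (t +i* y)) = cint setT (fun t => H (t +i* 0)).
  move: yd; rewrite ler_norml => /andP[y1 y2]; have e0 := eta_gt0; have [y0|y0] := leP y 0.
    by apply: H_shift => //; exact: ltW.
  by apply/esym/H_shift; lra.
rewrite -cint_real; apply: eq_cint => t _.
by rewrite /H complexr0 f_real b_real -!rmorphM -rmorphXn -rmorphM.
Qed.

Lemma off_axis_neq0 t y : `|y| <= eta -> y != 0 -> gamma (t +i* y) != 0.
Proof.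
move=> yd y0; apply/eqP => /(gamma_zeros (strip_line t yd))[x _ [_ yE]].
by rewrite yE eqxx in y0.
Qed.

Lemma G_ccont z : strip delta z -> gamma z != 0 -> ccont G z.
Proof.
move=> zs gz; apply: ccont_derivable.
exact: (derivable_mul_logderiv zs gamma_analytic F_analytic gz).
Qed.

Lemma G_cintable y : `|y| = eta -> cintable setT (fun t => G (t +i* y)).
Proof.
move=> yd; have yd' : `|y| <= eta by rewrite yd.
have y0 : y != 0 by rewrite -normr_gt0 yd.
have [r [r0 _ dec]] := gamma_decay.
have [M HM] := dec (m + 2) _ ltr01.
apply: (@cintable_decay _ _ M) => [t|t Mt].
  apply/ccont_horizontal/G_ccont; [exact: strip_line|exact: off_axis_neq0].
(* A point of either line is at distance at least [delta / 2 >= r x] from every real [x], and the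
   discs are open. *)
have nd : (strip delta `\` discs D r) (t +i* y).
  split; first exact: strip_line.
  move=> [x Dx]; have /andP[_ rx] := r0 x Dx.
  have := normc_Im ((t +i* y) - x%:C); rewrite raddfB /= subr0 yd; lra.
have := HM _ nd Mt; rewrite ger0_norm ?normc_ge0// => /ltW; apply: le_trans.
have -> : normc ((t +i* y) ^+ (m + 2) * f (t +i* y) * logderiv gamma (t +i* y)) =
    normc (t +i* y) ^+ 2 * normc (G (t +i* y)).
  by rewrite /G /F exprD !(normcX, normcM); ring.
rewrite ler_wpM2r ?normc_ge0// -real_normK ?num_real// lerXn2r ?nnegrE ?normc_ge0//.
exact: (normc_Re (t +i* y)).
Qed.

(** One sequence of rectangle integrals has two limits: the difference of the line integrals by
    decay, and the sum over [D] by the argument principle together with summability. *)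
Lemma residue_sum :
  cint setT (fun t => G (t +i* (- eta))) - cint setT (fun t => G (t +i* eta)) =
  two_pi_i R * (dsum D (fun x => x ^+ m * on_real f x))%:C.
Proof.
have [r [r0 sep dec]] := gamma_decay.
have r_gt0 x : D x -> 0 < r x by move=> /r0 /andP[].
have exA (k : nat) : exists t : R, t <= - k%:R /\ uncovered D r t.
  by have [t t1 t2] := uncovered_left r_gt0 sep (- k%:R); exists t.
have exB (k : nat) : exists t : R, k%:R <= t /\ uncovered D r t.
  by have [t t1 t2] := uncovered_right r_gt0 sep k%:R; exists t.
have [A HA] := choice exA; have [B HB] := choice exB.
have A1 k : A k <= - k%:R by have [] := HA k.
have B1 k : k%:R <= B k by have [] := HB k.
have k0 k : 0 <= k%:R :> R by [].
have e0 := eta_gt0.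
(* The radii are positive, so a point of [D] is covered by its own disc: no pole lies on the
   vertical sides. *)
have unc_notin t : uncovered D r t -> ~ D t.
  by move=> ct Dt; have := ct t Dt; rewrite subrr normr0 leNgt r_gt0.
have yd s : - eta <= s <= eta -> `|s| <= eta by rewrite ler_norml.
have unc_nd t s : uncovered D r t -> - eta <= s <= eta -> (strip delta `\` discs D r) (t +i* s).
  move=> ct se; split; first exact/strip_line/yd.
  move=> [x Dx]; have := ct x Dx; have := normc_Re ((t +i* s) - x%:C).
  by rewrite raddfB /= distrC; lra.
have unc_neq0 t s : uncovered D r t -> - eta <= s <= eta -> gamma (t +i* s) != 0.
  move=> ct se; apply/eqP => /(gamma_zeros (strip_line t (yd _ se)))[x Dx [tx _]].
  by apply: (unc_notin t ct); rewrite tx.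
have cG t s : uncovered D r t -> - eta <= s <= eta -> ccont G (t +i* s).
  by move=> ct se; apply: G_ccont; [exact/strip_line/yd|exact: unc_neq0].
have yy : - eta <= eta by lra.
have L : rint G (A k) (B k) (- eta) eta @[k --> \oo] -->
    cint setT (fun t => G (t +i* (- eta))) - cint setT (fun t => G (t +i* eta)).
  apply: rint_limit => //.
  - by apply: G_cintable; rewrite normrN gtr0_norm.
  - by apply: G_cintable; rewrite gtr0_norm.
  - by move=> k s se; split; apply: cG => //; [have [] := HA k|have [] := HB k].
  - move=> e ee; have [M HM] := dec m _ ee; have [N HN] := nat_ge M.
    exists N => k s Nk se; have kM := HN _ Nk.
    have [_ cA] := HA k; have [_ cB] := HB k.
    have hA := HM _ (unc_nd _ _ cA se); have hB := HM _ (unc_nd _ _ cB se).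
    have nA : M < `|A k| by rewrite ler0_norm; have := A1 k; have := k0 k; lra.
    have nB : M < `|B k| by rewrite ger0_norm; have := B1 k; have := k0 k; lra.
    split; apply: ltW.
      by have := hA nA; rewrite ger0_norm ?normc_ge0.
    by have := hB nB; rewrite ger0_norm ?normc_ge0.
pose S k := finmap.enum_fset (fset_set (D `&` `[A k, B k])).
have fD k : finite_set (D `&` `[A k, B k]) by exact: finite_discrete.
have inS k x : x \in S k <-> D x /\ A k <= x <= B k.
  have := in_fset_set (fD k) x; rewrite /S => ->; split.
    by rewrite inE /= in_itv.
  by rewrite inE /= in_itv.
have E k : rint G (A k) (B k) (- eta) eta =
    two_pi_i R * (\sum_(x <- S k) x ^+ m * on_real f x)%:C.
  rewrite (@argument_principle _ delta _ _ _ _ gamma F [seq x%:C | x <- S k]) //; last first.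
  - move=> [x y] /andP[/= xAB ye].
    rewrite (gamma_zeros (strip_line x (yd _ ye))); split.
      move=> [u Du [xu ->]]; rewrite xu in xAB *; apply/mapP; exists u => //.
      by apply/inS; split.
    by move=> /mapP[u /inS[Du _] ->]; exists u.
  - move=> _ /mapP[u /inS[Du uAB] ->]; split; last exact: gamma_simple.
    have nA : u != A k by apply/eqP => uA; apply: (unc_notin (A k)); [have [] := HA k|rewrite -uA].
    have nB : u != B k by apply/eqP => uB; apply: (unc_notin (B k)); [have [] := HB k|rewrite -uB].
    rewrite /inside /= !lt_neqAle (eq_sym (A k)) nA nB uAB /=.
    by rewrite !lt_eqF//= ?oppr_lt0//; apply/andP; split; lra.
  - by rewrite map_inj_uniq ?finmap.fset_uniq//; exact: complexI.
  - by lra.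
  - by lra.
  - have := A1 k; have := B1 k; have := k0 k; lra.
  congr (_ * _); rewrite big_map rmorph_sum; apply: eq_bigr => x _.
  by rewrite /F f_real -rmorphXn -rmorphM.
have L2 : two_pi_i R * (\sum_(x <- S k) x ^+ m * on_real f x)%:C @[k --> \oo] -->
    two_pi_i R * (dsum D (fun x => x ^+ m * on_real f x))%:C.
  apply: cvgMr; apply: cvg_ReIm => /=; last exact: cvg_cst.
  exact: sum_cvg_dsum.
have EE : (fun k => rint G (A k) (B k) (- eta) eta) =
    (fun k => two_pi_i R * (\sum_(x <- S k) x ^+ m * on_real f x)%:C).
  by apply/funext => k; exact: E.
rewrite EE in L.
exact: (cvg_unique (@norm_hausdorff _ _) L L2).
Qed.

(** The [G] parts add up to the lower minus the upper line integral over [two_pi_i], which is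
    [residue_sum]; the [H] parts are two halves of the same real integral by [H_line]. *)
Theorem contour_quadrature :
  let W := fun z => z ^+ m * (f z * vfun gamma b z) in
  contour_integrable delta W /\
  contour_integral delta W =
    (dsum D (fun x => x ^+ m * on_real f x))%:C -
    (\int[mu]_x (x ^+ m * (on_real f x * on_real b x)))%R%:C.
Proof.
move=> W; have e0 := eta_gt0; have t0 := two_pi_i_neq0 R.
have mT : measurable (setT : set (measurableTypeR R)) by exact: measurableT.
have d1 : `|eta| = eta by rewrite gtr0_norm.
have d2 : `|- eta| = eta by rewrite normrN.
have g1 := G_cintable d1; have g2 := G_cintable d2.
have h1 : cintable setT (fun t => H (t +i* eta)) by apply: H_cintable; rewrite d1.
have h2 : cintable setT (fun t => H (t -i* eta)) by apply: H_cintable; rewrite d2.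
have W1 : (fun t => W (t +i* eta)) =
    (fun t => (- (two_pi_i R)^-1) * G (t +i* eta) + (- 2^-1) * H (t +i* eta)).
  by apply/funext => t; rewrite /W /vfun /= e0 /G /F /H; field.
have W2 : (fun t => W (t -i* eta)) =
    (fun t => (two_pi_i R)^-1 * G (t -i* eta) + (- 2^-1) * H (t -i* eta)).
  apply/funext => t; rewrite /W /vfun /= oppr_gt0 ltNge (ltW e0) /= /G /F /H; by field.
have i1 : cintable setT (fun t => W (t +i* eta)).
  by rewrite W1; apply: cintableD => //; exact: cintableZ.
have i2 : cintable setT (fun t => W (t -i* eta)).
  by rewrite W2; apply: cintableD => //; exact: cintableZ.
split; first by split.
rewrite /contour_integral -[cintegral _]/(cint setT (fun t => W (t +i* eta))).
rewrite -[cintegral _]/(cint setT (fun t => W (t -i* eta))) W1 W2.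
rewrite !cintD//; try exact: cintableZ.
rewrite !cintZ// !H_line ?d1 ?d2//.
have := residue_sum; set X := cint _ _; set Y := cint _ _; set Z := _%:C; set I := _%:C => XY.
have -> : - (two_pi_i R)^-1 * Y + - 2^-1 * I + ((two_pi_i R)^-1 * X + - 2^-1 * I) =
  (two_pi_i R)^-1 * (X - Y) - I by field.
by rewrite XY mulKf.
Qed.

End StripQuadrature.

(** * Fredholm determinants of finite rank kernels *)

Section FiniteRankFredholm.
Variables (R : realType) (delta : R).
Local Notation C := R[i].
Implicit Types (u v : C -> C).

Let mT : measurable (setT : set (measurableTypeR R)).
Proof. exact: measurableT. Qed.

Lemma contour_upper x : contour delta (x +i* (delta / 2)).
Proof. by left. Qed.

Lemma contour_lower x : contour delta (x -i* (delta / 2)).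
Proof. by right. Qed.

Lemma eq_contour_integral u v : (forall z, contour delta z -> u z = v z) ->
  contour_integral delta u = contour_integral delta v.
Proof.
move=> uv; congr (_ + _); apply: (@eq_cint R setT) => x _; apply: uv.
  exact: contour_upper.
exact: contour_lower.
Qed.

Lemma eq_contour_integrable u v : (forall z, contour delta z -> u z = v z) ->
  contour_integrable delta u -> contour_integrable delta v.
Proof.
move=> uv [i1 i2]; split.
- by apply: (@eq_cintable R setT mT _ _ _ i1) => x _; apply: uv; exact: contour_upper.
- by apply: (@eq_cintable R setT mT _ _ _ i2) => x _; apply: uv; exact: contour_lower.
Qed.

Lemma contour_integrableZ k u : contour_integrable delta u ->
  contour_integrable delta (fun z => k * u z).
Proof. by move=> [i1 i2]; split; [exact: (cintableZ mT k i1)|exact: (cintableZ mT k i2)]. Qed.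

Lemma contour_integralZ k u : contour_integrable delta u ->
  contour_integral delta (fun z => k * u z) = k * contour_integral delta u.
Proof.
move=> [i1 i2]; rewrite /contour_integral mulrDr; congr (_ + _).
  exact: (cintZ mT k i1).
exact: (cintZ mT k i2).
Qed.

Lemma contour_integral_sum (I : Type) (s : seq I) (P : pred I) (u : I -> C -> C) :
  (forall i, P i -> contour_integrable delta (u i)) ->
  contour_integrable delta (fun z => \sum_(i <- s | P i) u i z) /\
  contour_integral delta (fun z => \sum_(i <- s | P i) u i z) =
    \sum_(i <- s | P i) contour_integral delta (u i).
Proof.
move=> ui.
have [i1 e1] := @cint_sum R setT mT I s P (fun i x => u i (x +i* (delta / 2)))
  (fun i Pi => (ui i Pi).1).
have [i2 e2] := @cint_sum R setT mT I s P (fun i x => u i (x -i* (delta / 2)))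
  (fun i Pi => (ui i Pi).2).
split; first by split.
rewrite /contour_integral big_split /=; congr (_ + _); [exact: e1|exact: e2].
Qed.

(** For sums of products the iterated integral factors one variable at a time, with no appeal to
    Fubini. [F] is constrained only on lists of the right length with entries on the contour, which
    is all that the integral sees. *)
Lemma contour_mintegral_sum_prod (A : finType) (k : nat) (c : A -> C)
    (u : A -> 'I_k -> C -> C) (F : seq C -> C) :
  (forall a i, contour_integrable delta (u a i)) ->
  (forall s, size s = k -> (forall z, z \in s -> contour delta z) ->
     F s = \sum_a c a * \prod_(i < k) u a i s`_i) ->
  contour_mintegrable delta k F /\
  contour_mintegral delta k F = \sum_a c a * \prod_(i < k) contour_integral delta (u a i).
Proof.
elim: k c u F => [|k IH] c u F ui FE /=.
  split=> //; rewrite FE//; apply: eq_bigr => a _.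
  by rewrite !big_ord0.
pose u' a i := u a (lift ord0 i).
have step z : contour delta z ->
    contour_mintegrable delta k (fun s => F (z :: s)) /\
    contour_mintegral delta k (fun s => F (z :: s)) =
    \sum_a (c a * \prod_(i < k) contour_integral delta (u' a i)) * u a ord0 z.
  move=> zc; have [|s sk sc|H1 H2] := IH (fun a => c a * u a ord0 z) u' (fun s => F (z :: s)).
  - by move=> a i; exact: ui.
  - rewrite FE /= ?sk//; last by move=> w; rewrite inE => /predU1P[->//|/sc].
    by apply: eq_bigr => a _; rewrite big_ord_recl mulrA.
  - by split=> //; rewrite H2; apply: eq_bigr => a _; rewrite mulrAC.
have [H1 H2] := @contour_integral_sum _ (index_enum A) predT
  (fun a z => (c a * \prod_(i < k) contour_integral delta (u' a i)) * u a ord0 z)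
  (fun a _ => contour_integrableZ _ (ui a ord0)).
split.
  split; first by move=> z /step[].
  by apply: (eq_contour_integrable _ H1) => z /step[_ ->].
rewrite (@eq_contour_integral _ _ (fun z zc => (step z zc).2)) H2.
apply: eq_bigr => a _; rewrite contour_integralZ; last exact: ui.
by rewrite big_ord_recl -mulrA; congr (_ * _); rewrite mulrC.
Qed.

Section Kernel.
Variables (n : nat) (P : 'I_n -> C -> C) (K : C -> C -> C) (g W : C -> C).
Hypothesis gW : forall z, contour delta z -> g z ^+ 2 = W z.
Hypothesis KE : forall z w, contour delta z -> contour delta w ->
  K z w = (\sum_l P l z * P l w) * (g z * g w).
Hypothesis PPW : forall l m, contour_integrable delta (fun z => P l z * P m z * W z).

Let M : 'M[C]_n := \matrix_(l, m) contour_integral delta (fun z => P l z * P m z * W z).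

(** Leibniz formula, with the sum over [l] in row [i] expanded by a choice [phi i]. Reindexing the
    column factors by [t] collects everything that depends on the same variable [s_i]. *)
Lemma kernel_det_expand k s : size s = k -> (forall z, z \in s -> contour delta z) ->
  kernel_det K k s = \sum_(a : 'S_k * {ffun 'I_k -> 'I_n})
    (-1) ^+ a.1 * \prod_(i < k) (P (a.2 i) s`_i * P (a.2 ((a.1^-1)%g i)) s`_i * W s`_i).
Proof.
move=> sk sc; have si (i : 'I_k) : contour delta s`_i by apply: sc; rewrite mem_nth// sk.
rewrite -(pair_big predT predT (fun (t : 'S_k) (phi : {ffun 'I_k -> 'I_n}) => (-1) ^+ t *
    \prod_(i < k) (P (phi i) s`_i * P (phi ((t^-1)%g i)) s`_i * W s`_i))) /=.
apply: eq_bigr => t _; rewrite -mulr_sumr; congr (_ * _).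
under eq_bigr => i _ do rewrite mxE KE//.
rewrite big_split big_split /= bigA_distr_bigA /=.
(* Row and column factors of [g] run over the same points, so each [g s_i] occurs squared, whatever
   the permutation. *)
have -> : \prod_(i < k) g s`_(t i) = \prod_(i < k) g s`_i.
  by rewrite [RHS](reindex_inj (@perm_inj _ t)).
rewrite -big_split /= (eq_bigr (fun i : 'I_k => W s`_i)); last by move=> i _; rewrite -gW.
rewrite mulr_suml; apply: eq_bigr => phi _.
rewrite !big_split /=; congr (_ * _ * _).
rewrite [RHS](reindex_inj (@perm_inj _ t)) /=.
by apply: eq_bigr => i _; rewrite permK.
Qed.

Lemma kernel_det_integral k : contour_mintegrable delta k (kernel_det K k) /\
  contour_mintegral delta k (kernel_det K k) =
    \sum_(phi : {ffun 'I_k -> 'I_n}) \det (mxsub phi phi M).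
Proof.
have [|H1 H2] := @contour_mintegral_sum_prod _ k _ (fun (a : 'S_k * {ffun 'I_k -> 'I_n}) i z =>
    P (a.2 i) z * P (a.2 ((a.1^-1)%g i)) z * W z) _ _ (@kernel_det_expand k).
  by move=> a i; exact: PPW.
split=> //; rewrite H2.
rewrite -(pair_big predT predT (fun (t : 'S_k) (phi : {ffun 'I_k -> 'I_n}) => (-1) ^+ t *
    \prod_(i < k) contour_integral delta
      (fun z => P (phi i) z * P (phi ((t^-1)%g i)) z * W z))) /=.
rewrite exchange_big /=; apply: eq_bigr => phi _.
(* Passing to the inverse permutation, which has the same sign, gives the Leibniz formula of the
   minor. *)
rewrite (reindex_inj invg_inj) /=; apply: eq_bigr => t _.
by rewrite odd_permV invgK; congr (_ * _); apply: eq_bigr => i _; rewrite !mxE.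
Qed.

(** No set of indices below [n] has more than [n] elements, so the terms with [k > n] vanish and the
    partial sums are constant from [n.+1] on. *)
Theorem fredholm_finite_rank :
  fredholm_well_defined delta K /\ fredholm_det delta K = \det (1%:M + M).
Proof.
have term k : fredholm_term delta K k =
    (k`!%:R)^-1 * \sum_(phi : {ffun 'I_k -> 'I_n}) \det (mxsub phi phi M).
  by rewrite /fredholm_term (kernel_det_integral k).2.
have seriesE N : (n < N)%N -> series (fredholm_term delta K) N = \det (1%:M + M).
  move=> nN; have tail : \sum_(n.+1 <= k < N) fredholm_term delta K k = 0.
    rewrite big_nat_cond big1// => k /andP[/andP[nk _] _].
    by rewrite term sum_det_mxsub0 ?mulr0.
  rewrite /series /= (big_cat_nat (n := n.+1))//= tail addr0 det_1D_fredholm.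
    by apply: eq_bigr => k _; exact: term.
  by move=> k; rewrite pnatr_eq0 -lt0n fact_gt0.
have L : series (fredholm_term delta K) @ \oo --> \det (1%:M + M).
  apply/cvgrPdist_le => e e0; exists n.+1 => // N /= nN.
  by rewrite seriesE// subrr normr0 ltW.
split; last exact: (cvg_lim (@norm_hausdorff _ _) L).
by split; [move=> k; have [] := kernel_det_integral k|apply/cvg_ex; exists (\det (1%:M + M))].
Qed.

End Kernel.
End FiniteRankFredholm.

(** * The Christoffel-Darboux formula *)

Section ChristoffelDarboux.

(** The same [al k] links [k] to [k.+1] in both directions, so the [be] terms cancel and the rest
    telescopes. A general ring allows the use with [x = 'X] and [y] a constant polynomial. *)
Lemma christoffel_darboux_sum (A : comPzRingType) (x y : A) (u v al be : nat -> A) :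
  (forall k, x * u k = al k * u k.+1 + be k * u k + (if k is j.+1 then al j * u j else 0)) ->
  (forall k, y * v k = al k * v k.+1 + be k * v k + (if k is j.+1 then al j * v j else 0)) ->
  forall n, (x - y) * \sum_(k < n.+1) u k * v k = al n * (u n.+1 * v n - u n * v n.+1).
Proof.
move=> xu yv; elim=> [|n IH].
  rewrite big_ord1; have -> : (x - y) * (u 0 * v 0) = x * u 0 * v 0 - u 0 * (y * v 0) by ring.
  by rewrite xu yv /=; ring.
rewrite big_ord_recr mulrDr IH /=.
have -> : (x - y) * (u n.+1 * v n.+1) = x * u n.+1 * v n.+1 - u n.+1 * (y * v n.+1) by ring.
by rewrite xu yv; ring.
Qed.

Variables (F : fieldType) (p : nat -> {poly F}).
Hypothesis size_p : forall k, size (p k) = k.+1.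

Lemma poly_span k (q : {poly F}) : (size q <= k)%N -> exists c : nat -> F,
  q = \sum_(j < k) c j *: p j.
Proof.
elim: k q => [|k IH] q sq.
  by exists (fun=> 0); rewrite big_ord0; apply/eqP; rewrite -size_poly_leq0.
have lp : lead_coef (p k) != 0 by rewrite lead_coef_eq0 -size_poly_gt0 size_p.
have [|c Ec] := IH (q - (q`_k / lead_coef (p k)) *: p k).
  apply/leq_sizeP => j; rewrite leq_eqVlt coefB coefZ => /predU1P[<-|kj].
    by rewrite lead_coefE size_p /= divfK ?subrr// -[_`_k]/((p k)`_(k.+1.-1)) -(size_p k) -lead_coefE.
  rewrite (@nth_default _ 0 q j) ?(leq_trans sq)// (@nth_default _ 0 (p k) j) ?size_p//.
  by rewrite mulr0 subr0.
exists (fun j => if j == k then q`_k / lead_coef (p k) else c j).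
rewrite big_ord_recr /= eqxx.
rewrite (eq_bigr (fun j : 'I_k => c j *: p j)); last by move=> j _; rewrite ltn_eqF.
by rewrite -Ec subrK.
Qed.

Variable Lam : {poly F} -> F.
Hypothesis LamD : forall q r, Lam (q + r) = Lam q + Lam r.
Hypothesis LamZ : forall c q, Lam (c *: q) = c * Lam q.
Hypothesis Lam_ortho : forall j k, Lam (p j * p k) = (j == k)%:R.

Lemma Lam_sum k (c : nat -> F) (q : nat -> {poly F}) :
  Lam (\sum_(j < k) c j *: q j) = \sum_(j < k) c j * Lam (q j).
Proof.
elim: k => [|k IH]; first by rewrite !big_ord0 -(scale0r 0) LamZ mul0r.
by rewrite !big_ord_recr /= LamD LamZ IH.
Qed.

Lemma Lam_coord k (c : nat -> F) j : (j < k)%N ->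
  Lam ((\sum_(i < k) c i *: p i) * p j) = c j.
Proof.
move=> jk; rewrite mulr_suml.
under eq_bigr => i _ do rewrite -scalerAl.
rewrite (Lam_sum k c (fun i => p i * p j)) (bigD1 (Ordinal jk))//= Lam_ortho eqxx mulr1.
rewrite big1 ?addr0// => i ij; rewrite Lam_ortho.
by rewrite (_ : (_ == _) = false) ?mulr0//; apply/negbTE.
Qed.

Lemma Lam_low k (q : {poly F}) : (size q <= k)%N -> Lam (q * p k) = 0.
Proof.
move=> /poly_span[c ->]; rewrite mulr_suml.
under eq_bigr => i _ do rewrite -scalerAl.
rewrite (Lam_sum k c (fun i => p i * p k)) big1// => i _.
by rewrite Lam_ortho ltn_eqF ?mulr0.
Qed.

Definition rec_alpha k := lead_coef (p k) / lead_coef (p k.+1).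
Definition rec_beta k := Lam ('X * p k * p k).

(** The coordinate of ['X * p k] along [p j] is [Lam ('X * p k * p j)]. Moving ['X] to [p j] shows
    that it vanishes for [j + 1 < k], and that for [j = k - 1] it is the [rec_alpha] of the
    preceding step. *)
Lemma three_term k : 'X * p k = rec_alpha k *: p k.+1 + rec_beta k *: p k +
  (if k is j.+1 then rec_alpha j *: p j else 0).
Proof.
have pn0 j : p j != 0 by rewrite -size_poly_gt0 size_p.
have sX j : size ('X * p j) = j.+2 by rewrite mulrC size_mulX// size_p.
(* The top coordinate is found by comparing leading coefficients. *)
have alphaE j : Lam ('X * p j * p j.+1) = rec_alpha j.
  have [c Ec] : exists c : nat -> F, 'X * p j = \sum_(i < j.+2) c i *: p i.
    by apply: poly_span; rewrite sX.
  rewrite Ec Lam_coord// /rec_alpha.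
  have := congr1 (fun q : {poly F} => q`_j.+1) Ec; rewrite coefXM /= big_ord_recr coefD coefZ.
  rewrite coef_sum big1 ?add0r => [|i _]; last first.
    by rewrite coefZ nth_default ?mulr0// size_p; exact: (ltn_ord i).
  rewrite !lead_coefE !size_p /= => ->; rewrite mulfK//.
  by rewrite -[_`_j.+1]/((p j.+1)`_(j.+2.-1)) -(size_p j.+1) -lead_coefE lead_coef_eq0.
have [c Ec] : exists c : nat -> F, 'X * p k = \sum_(i < k.+2) c i *: p i.
  by apply: poly_span; rewrite sX.
have cE j : (j < k.+2)%N -> c j = Lam ('X * p k * p j) by move=> jk; rewrite Ec Lam_coord.
have c1 : c k.+1 = rec_alpha k by rewrite cE// alphaE.
have c0 : c k = rec_beta k by rewrite cE.
rewrite Ec big_ord_recr big_ord_recr /= c1 c0 -addrA addrC [X in X + _]addrC; congr (_ + _).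
clear c1 c0.
case: k Ec cE => [|k] Ec cE; first by rewrite big_ord0.
rewrite big_ord_recr /= big1 ?add0r => [|i _]; last first.
  rewrite cE; last by apply: (leq_trans (ltn_ord i)); rewrite -[k.+3]addn3 leq_addr.
  rewrite mulrAC Lam_low ?scale0r// sX ltnS.
  exact: ltn_ord.
rewrite cE; last by rewrite ltnS; exact: leqW (leqW (leqnn k)).
by rewrite mulrAC alphaE.
Qed.

End ChristoffelDarboux.

Section ChristoffelDarbouxKernel.
Variables (R : realType) (p : nat -> {poly R}) (Lam : {poly R} -> R).
Local Notation C := R[i].
Hypothesis size_p : forall k, size (p k) = k.+1.
Hypothesis LamD : forall q r, Lam (q + r) = Lam q + Lam r.
Hypothesis LamZ : forall c q, Lam (c *: q) = c * Lam q.
Hypothesis Lam_ortho : forall j k, Lam (p j * p k) = (j == k)%:R.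

Let P k : {poly C} := map_poly (real_complex R) (p k).
Let al k : C := (rec_alpha p k)%:C.
Let be k : C := (rec_beta p Lam k)%:C.

Let P_rec k : 'X * P k = (al k)%:P * P k.+1 + (be k)%:P * P k +
  (if k is j.+1 then (al j)%:P * P j else 0).
Proof.
have := congr1 (map_poly (real_complex R)) (three_term size_p LamD LamZ Lam_ortho k).
rewrite rmorphM /= map_polyX => ->; rewrite !rmorphD /= !map_polyZ !mul_polyC.
by case: k => [|k]; rewrite ?rmorph0// map_polyZ mul_polyC.
Qed.

(** Only the first variable is kept as an indeterminate, so that the identity can be evaluated at
    [z] or differentiated at [w]. *)
Lemma christoffel_darboux_poly n (w : C) :
  ('X - w%:P) * \sum_(k < n.+1) P k * (P k).[w]%:P =
  (al n)%:P * (P n.+1 * (P n).[w]%:P - P n * (P n.+1).[w]%:P).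
Proof.
apply: (christoffel_darboux_sum P_rec (v := fun k => (P k).[w]%:P)) => k.
have := congr1 (fun q : {poly C} => q.[w]%:P) (P_rec k).
rewrite hornerM hornerX !hornerD !hornerM !hornerC => E.
rewrite -polyCM E !polyCD !polyCM; case: k {E} => [|k]; first by rewrite horner0.
by rewrite hornerM hornerC polyCM.
Qed.

Theorem K_CD_sum n (z w : C) : (0 < n)%N ->
  K_CD p n z w = \sum_(k < n) ceval (p k) z * ceval (p k) w.
Proof.
case: n => // n _; rewrite /K_CD /kappa /= -[(_ / _)%:C]/(al n).
have E := christoffel_darboux_poly n w.
case: eqVneq => [->|zw].
  (* On the diagonal the factor ['X - w] vanishes at [w]; differentiating there leaves the sum
     itself on the left and the diagonal value of [K_CD] on the right. *)
  have := congr1 (fun q => (deriv q).[w]) E; cbv beta.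
  have dL (q : {poly C}) : (deriv (('X - w%:P) * q)).[w] = q.[w].
    rewrite derivM derivXsubC mul1r hornerD hornerM hornerXsubC subrr mul0r addr0 //.
  have dR (q1 q2 : {poly C}) c c1 c2 : (deriv (c%:P * (q1 * c1%:P - q2 * c2%:P))).[w] =
      c * ((deriv q1).[w] * c1 - (deriv q2).[w] * c2).
    rewrite mul_polyC derivZ derivB ![_ * _%:P]mulrC !mul_polyC !derivZ.
    by rewrite hornerZ hornerD hornerN !hornerZ; ring.
  rewrite dL dR => E2.
  have -> : \sum_(k < n.+1) ceval (p k) w * ceval (p k) w =
      \sum_(k < n.+1) (P k * (P k).[w]%:P).[w].
    by apply: eq_bigr => k _; rewrite hornerM hornerC.
  by rewrite -horner_sum E2 /ceval !deriv_map.
have E2 := congr1 (fun q : {poly C} => q.[z]) E.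
rewrite !hornerM !hornerD !hornerN !hornerM !hornerC hornerX horner_sum in E2.
have {}E2 : (z - w) * \sum_(k < n.+1) ceval (p k) z * ceval (p k) w =
    al n * ((P n.+1).[z] * (P n).[w] - (P n).[z] * (P n.+1).[w]).
  by rewrite -E2; congr (_ * _); apply: eq_bigr => k _; rewrite hornerM hornerC.
apply: (mulfI (x := z - w)); first by rewrite subr_eq0.
have key (a X d : C) : d != 0 -> d * (a * (X / d)) = a * X by move=> d0; field.
by rewrite E2 key ?subr_eq0.
Qed.

End ChristoffelDarbouxKernel.

(** * Moments *)

Section MomentFunctional.
Variables (R : realType) (w : R -> R) (p : nat -> {poly R}).
Local Notation mu := (@lebesgue_measure R).
Hypothesis p_ortho : orthonormal_polys w p.

Definition moment (q : {poly R}) : R := (\int[mu]_x (q.[x] * w x))%R.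

Let mT : measurable (setT : set (measurableTypeR R)).
Proof. exact: measurableT. Qed.

(** Orthonormality provides integrability of [p 0 * p j * w] only; as [p 0] is a nonzero constant it
    can be divided out, and the [p j] span all polynomials. *)
Lemma moment_integrable q : mu.-integrable setT (EFin \o (fun x => q.[x] * w x)).
Proof.
have [size_p ortho] := p_ortho.
have [c ->] := poly_span size_p (leqnn (size q)).
have p0 : p 0 = ((p 0)`_0)%:P by apply: size1_polyC; rewrite size_p.
have p00 : (p 0)`_0 != 0.
  by have := size_p 0; rewrite {1}p0 size_polyC; case: eqP.
have p0x x : (p 0).[x] = (p 0)`_0 by rewrite {1}p0 hornerC.
have pj j : mu.-integrable setT (EFin \o (fun x => (p j).[x] * w x)).
  have [ij _] := ortho 0 j.
  apply: (eq_integrable_on mT _ (integrableZl mT ((p 0)`_0)^-1 ij)) => x _ /=.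
  by rewrite p0x -EFinM -!mulrA mulKf.
elim: (size q) => [|k IH].
  apply: (eq_integrable_on mT _ (integrable0 mu setT)) => x _ /=.
  by rewrite big_ord0 horner0 mul0r.
apply: (eq_integrable_on mT _ (integrableD mT IH (integrableZl mT (c k) (pj k)))) => x _ /=.
by rewrite big_ord_recr /= hornerD hornerZ mulrDl -mulrA.
Qed.

Lemma momentD q r : moment (q + r) = moment q + moment r.
Proof.
rewrite /moment -RintegralD//; [|exact: moment_integrable|exact: moment_integrable].
by apply: eq_Rintegral => x _; rewrite hornerD mulrDl.
Qed.

Lemma momentZ c q : moment (c *: q) = c * moment q.
Proof.
rewrite /moment -RintegralZl//; last exact: moment_integrable.
by apply: eq_Rintegral => x _; rewrite hornerZ mulrA.
Qed.

Lemma moment_ortho j k : moment (p j * p k) = (j == k)%:R.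
Proof.
have [_ /(_ j k)[_ <-]] := p_ortho.
by apply: eq_Rintegral => x _; rewrite hornerM.
Qed.

Definition coef_mx n : 'M[R]_n := \matrix_(j, l) (p j)`_l.
Definition moment_mx n : 'M[R]_n := \matrix_(j, k) moment 'X^(j + k).

Lemma poly_coef_wide n (j : 'I_n) : p j = \sum_(l < n) (p j)`_l *: 'X^l.
Proof.
have [size_p _] := p_ortho.
rewrite -poly_def; apply/polyP => l; rewrite coef_poly; case: ltnP => // nl.
by rewrite nth_default// size_p (leq_trans _ nl).
Qed.

(** The left-hand side is the Gram matrix of [p 0, ..., p (n-1)] for the weight [w], written in the
    monomial basis. *)
Lemma coef_moment_mx n : coef_mx n *m moment_mx n *m (coef_mx n)^T = 1%:M.
Proof.
apply/matrixP => j k; rewrite [RHS]mxE -[(j == k)%:R]/((j == k :> nat)%:R) -moment_ortho.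
rewrite [in RHS](poly_coef_wide k) mulr_sumr.
under [in RHS]eq_bigr => l _ do rewrite -scalerAr.
rewrite (Lam_sum momentD momentZ n (fun l => (p k)`_l) (fun l => p j * 'X^l)).
rewrite mxE; apply: eq_bigr => l _; rewrite [(coef_mx n)^T l k]mxE [coef_mx n k l]mxE mulrC.
congr (_ * _); rewrite [in RHS](poly_coef_wide j) mulr_suml.
under [in RHS]eq_bigr => i _ do rewrite -scalerAl -exprD.
rewrite (Lam_sum momentD momentZ n (fun i => (p j)`_i) (fun i => 'X^(i + l))).
by rewrite mxE; apply: eq_bigr => i _; rewrite !mxE.
Qed.

Lemma hankel_moment n : hankel n w = \det (moment_mx n).
Proof.
congr (\det _); apply/matrixP => j k; rewrite !mxE /moment.
by apply: eq_Rintegral => x _; rewrite hornerXn.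
Qed.

End MomentFunctional.

(** * The determinant identity *)

Theorem theorem2p1 (R : realType) (n : nat) (delta : R) (D : set R)
    (f b gamma g : R[i] -> R[i]) (p : nat -> {poly R})
    (n_gt0 : (0 < n)%N)
    (delta_gt0 : 0 < delta)
    (* (a) *)
    (D_discrete : limit_point D = set0)
    (* (b) *)
    (f_analytic : analytic_on (strip delta) f)
    (f_ge0 : forall x : R, 0 <= f x%:C)
    (f_nontrivial : exists x : R, f x%:C != 0)
    (f_hankel : discrete_hankel_defined n (on_real f) D)
    (* (c) *)
    (b_analytic : analytic_on (strip delta) b)
    (b_nontrivial : exists2 z : R[i], strip delta z & b z != 0)
    (b_ge0 : forall x : R, 0 <= b x%:C)
    (fb_decay : forall k : nat,
       vanishes_at_infty (strip delta) (fun z => normc z)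
         (fun z => normc z ^+ k * normc (f z * b z)))
    (* (d) *)
    (gamma_analytic : analytic_on (strip delta) gamma)
    (gamma_zeros : vanishes_exactly_on (strip delta) gamma D)
    (gamma_simple : forall x : R, D x -> derive1 gamma x%:C != 0)
    (gamma_decay : logderiv_decay delta D f gamma)
    (p_orthonormal :
       orthonormal_polys (fun x => on_real f x * on_real b x) p)
    (g_sqrt : forall z, contour delta z -> g z ^+ 2 = f z * vfun gamma b z) :
  let K := fun z w => K_CD p n z w * (g z * g w) in
  fredholm_well_defined delta K /\
  (discrete_hankel n (on_real f) D)%:C =
    (hankel n (fun x => on_real f x * on_real b x))%:C * fredholm_det delta K.
Proof.
move=> K.
pose w x := on_real f x * on_real b x.
pose W z := f z * vfun gamma b z.
pose P (l : 'I_n) := ceval (p l).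
pose L : 'M[R[i]]_n := map_mx (real_complex R) (coef_mx p n).
pose H : 'M[R[i]]_n := map_mx (real_complex R) (moment_mx w n).
pose Hd : 'M[R[i]]_n := \matrix_(j, k) (dsum D (fun x => x ^+ (j + k) * on_real f x))%:C.
pose V : 'M[R[i]]_n := \matrix_(j, k) contour_integral delta (fun z => z ^+ (j + k) * W z).
have [size_p _] := p_orthonormal.
have quad (j k : 'I_n) := contour_quadrature delta_gt0 D_discrete f_analytic f_ge0
  b_analytic b_ge0 fb_decay gamma_analytic gamma_zeros gamma_simple gamma_decay (f_hankel j k).
have HdE : Hd = H + V.
  apply/matrixP => j k; rewrite !mxE (quad j k).2 /moment addrC.
  rewrite (_ : (\int[lebesgue_measure]_x (('X^(j + k)).[x] * w x))%R =
    (\int[lebesgue_measure]_x (x ^+ (j + k) * (on_real f x * on_real b x)))%R) ?subrK//.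
  by apply: eq_Rintegral => x _; rewrite hornerXn.
have LHL : L *m H *m L^T = 1%:M.
  by rewrite /L /H map_trmx -!map_mxM (coef_moment_mx p_orthonormal) map_mx1.
have PE l z : P l z = \sum_(j < n) L l j * z ^+ j.
  rewrite /P /ceval [in LHS](poly_coef_wide p_orthonormal l) raddf_sum horner_sum.
  by apply: eq_bigr => j _; rewrite /= map_polyZ map_polyXn hornerZ hornerXn !mxE.
(* Expansion into monomials, to which the quadrature formula applies with exponents [j + k]. *)
have PPWE l m z : P l z * P m z * W z =
    \sum_(a : 'I_n * 'I_n) (L l a.1 * L m a.2) * (z ^+ (a.1 + a.2) * W z).
  rewrite !PE mulr_suml mulr_suml -(pair_big predT predT
    (fun j k : 'I_n => (L l j * L m k) * (z ^+ (j + k) * W z))) /=.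
  apply: eq_bigr => j _; rewrite mulr_sumr mulr_suml; apply: eq_bigr => k _.
  by rewrite exprD; ring.
have PPW l m := @contour_integral_sum _ delta _ (index_enum ('I_n * 'I_n)%type) predT
  (fun a z => (L l a.1 * L m a.2) * (z ^+ (a.1 + a.2) * W z))
  (fun a _ => contour_integrableZ _ (quad a.1 a.2).1).
have PPWi l m : contour_integrable delta (fun z => P l z * P m z * W z).
  by apply: (eq_contour_integrable _ (PPW l m).1) => z _; rewrite PPWE.
have KE z u : contour delta z -> contour delta u ->
    K z u = (\sum_l P l z * P l u) * (g z * g u).
  move=> _ _; rewrite /K (K_CD_sum size_p (momentD p_orthonormal) (momentZ p_orthonormal)
    (moment_ortho p_orthonormal))//.
have [wd detE] := fredholm_finite_rank g_sqrt KE PPWi.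
split=> //; rewrite detE.
have -> : \matrix_(l, m) contour_integral delta (fun z => P l z * P m z * W z) = L *m V *m L^T.
  apply/matrixP => l m; rewrite mxE.
  rewrite (eq_contour_integral (fun z _ => PPWE l m z)) (PPW l m).2.
  rewrite -(pair_big predT predT (fun j k : 'I_n => contour_integral delta
    (fun z => (L l j * L m k) * (z ^+ (j + k) * W z)))) /= exchange_big /= mxE.
  apply: eq_bigr => k _; rewrite [L^T k m]mxE [(L *m V) l k]mxE mulr_suml; apply: eq_bigr => j _.
  rewrite contour_integralZ; last exact: (quad j k).1.
  by rewrite [V j k]mxE mulrAC.
have -> : (discrete_hankel n (on_real f) D)%:C = \det Hd.
  by rewrite -det_map_mx; congr (\det _); apply/matrixP => j k; rewrite !mxE.
have -> : (hankel n (fun x => on_real f x * on_real b x))%:C = \det H.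
  by rewrite hankel_moment -det_map_mx.
(* [det H * (det L)^2 = 1]. With [1] replaced by [L H L^T], the Fredholm determinant becomes
   [det (L Hd L^T)], and this relation absorbs both factors [det L]. *)
have := congr1 determinant LHL; rewrite !det_mulmx det_tr det1 => detLHL.
rewrite -LHL -mulmxDl -mulmxDr -HdE !det_mulmx det_tr.
rewrite -[LHS]mul1r -detLHL; ring.
Qed.
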